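(* For any integer $d\ge 2$ and any lattice $x\in X_d$, the set $$\{y\in\pi^{-1}(x): y \text{ does not satisfy Minkowski's conjecture}\}$$ has Lebesgue measure zero in the torus $\pi^{-1}(x)\cong\mathbb{R}^d/x$.
   Context: $X_d=\mathrm{SL}_d(\mathbb{R})/\mathrm{SL}_d(\mathbb{Z})$ is identified with the space of unimodular (covolume 1) lattices in $\mathbb{R}^d$. A (unimodular) grid is a translated lattice $x+v=\{w+v:w\in x\}$ with $x\in X_d$, $v\in\mathbb{R}^d$; $Y_d$ is the space of grids, $\pi:Y_d\to X_d$ is $\pi(x+v)=x$, and the fiber $\pi^{-1}(x)$ is identified with the torus $\mathbb{R}^d/x$. Let $N:\mathbb{R}^d\to\mathbb{R}$ be $N(v)=\prod_{i=1}^d v_i$, and for a grid $y$ let $V_N(y)=\{N(v):v\in y\}$. A grid $y\in Y_d$ satisfies Minkowski's conjecture if $V_N(y)\cap[-2^{-d},2^{-d}]\neq\emptyset$. *)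

(* Defs.v *)
From HB Require Import structures.
From mathcomp Require Import all_boot all_order all_algebra.
From mathcomp Require Import all_classical all_reals all_analysis.
From mathcomp Require Import measurable_realfun.
Set Implicit Arguments.
Unset Strict Implicit.
Unset Printing Implicit Defensive.
Import Order.TTheory GRing.Theory Num.Theory.
Local Open Scope classical_set_scope.
Local Open Scope ring_scope.

Section lebesgue_measure_tuple.
Local Open Scope ereal_scope.
Context {R : realType}.
Local Notation T := (measurableTypeR R).

Definition tcons n (p : T * n.-tuple T) : n.+1.-tuple T :=
  [tuple of p.1 :: p.2].

Lemma measurable_tcons n : measurable_fun [set: T * n.-tuple T] (@tcons n).
Proof.
exact: (measurable_cons (f := fst) (g := snd) measurable_fst measurable_snd).
Qed.

Lemma tcons_inj n : injective (@tcons n).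
Proof. by move=> [a s] [b t] /(congr1 val)/= [-> /val_inj ->]. Qed.

Lemma measurable_image_tcons n (A : set (T * n.-tuple T)) :
  measurable A -> measurable (@tcons n @` A).
Proof.
move=> mA; pose f (t : n.+1.-tuple T) := (tnth t ord0, [tuple of behead t]).
have -> : @tcons n @` A = f @^-1` A.
  apply/seteqP; split => [_ [[a s] As <-]|t ft] /=.
    by rewrite /f (_ : [tuple of _] = s)//; exact/val_inj.
  by exists (f t) => //; rewrite [RHS]tuple_eta.
rewrite -[X in measurable X]setTI.
apply: (_ : measurable_fun setT f) => //.
apply: measurable_fun_pair; first exact: measurable_tnth.
exact: measurable_behead.
Qed.

Section step.
Variables (n : nat) (m : {sigma_finite_measure set (n.-tuple T) -> \bar R}).

Definition lebesgue_cons : set (n.+1.-tuple T) -> \bar R :=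
  pushforward ((@lebesgue_measure R) \x m) (@tcons n).

HB.instance Definition _ := Measure.copy lebesgue_cons
  (measure_function_pushforward__canonical__measure_function_Measure
     ((@lebesgue_measure R) \x m) (@measurable_tcons n)).

Let lebesgue_cons_sigma_finite : sigma_finite setT lebesgue_cons.
Proof.
have /sigma_finiteP[F [TF ndF mF]] := sigma_finiteT (@lebesgue_measure R).
have /sigma_finiteP[G [TG ndG mG]] := sigma_finiteT m.
have mFG k : measurable (F k `*` G k).
  by apply: measurableX; [have [] := mF k|have [] := mG k].
exists (fun k => @tcons n @` (F k `*` G k)).
  apply/seteqP; split => // t _.
  have [i _ Fi] : (\bigcup_k F k) (tnth t ord0) by rewrite -TF.
  have [j _ Gj] : (\bigcup_k G k) [tuple of behead t] by rewrite -TG.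
  exists (maxn i j) => //.
  exists (tnth t ord0, [tuple of behead t]); last by rewrite [RHS]tuple_eta.
  split => /=.
    by move: Fi; apply/subsetPset/ndF/leq_maxl.
  by move: Gj; apply/subsetPset/ndG/leq_maxr.
move=> k; split; first exact: measurable_image_tcons.
rewrite /lebesgue_cons /pushforward (_ : _ @^-1` _ = F k `*` G k); last first.
  by apply/seteqP; split => [p [q Fq /tcons_inj <-]//|p Fp]; exists p.
have [mFk Fk] := mF k; have [mGk Gk] := mG k.
by rewrite product_measure1E// lte_mul_pinfty// ge0_fin_numE.
Qed.

HB.instance Definition _ := Measure_isSigmaFinite.Build _ _ _ lebesgue_cons
  lebesgue_cons_sigma_finite.

End step.

Section base.

Definition lebesgue_nil : set (0.-tuple T) -> \bar R := @dirac _ _ [tuple] R.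

HB.instance Definition _ := FiniteMeasure.on lebesgue_nil.

End base.

(* Lebesgue measure on R^n, as the n-fold product of lebesgue_measure. *)
Fixpoint lebesgue_measure_tuple (n : nat) :
    {sigma_finite_measure set (n.-tuple T) -> \bar R} :=
  if n is m.+1 then lebesgue_cons (lebesgue_measure_tuple m) else lebesgue_nil.

Lemma lebesgue_measure_tuple_box n (A : 'I_n -> set T) :
  (forall i, measurable (A i)) ->
  lebesgue_measure_tuple n [set t | forall i, A i (tnth t i)] =
  \big[*%E/1]_(i < n) (@lebesgue_measure R) (A i).
Proof.
elim: n A => [|n IHn] A mA.
  by rewrite big_ord0 /= /lebesgue_nil diracE mem_set// => -[].
rewrite big_ord_recl -IHn => [|i]; last exact: mA.
rewrite /= /lebesgue_cons /pushforward.
rewrite -product_measure1E//=; last first.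
  rewrite (_ : [set _ | _] =
    \bigcap_(i in [set: 'I_n]) (fun t : n.-tuple T => tnth t i) @^-1`
      A (lift ord0 i)); last first.
    by apply/seteqP; split => t /= tA i; [move=> _; exact: tA|exact: (tA i I)].
  apply: fin_bigcap_measurable => // i _; rewrite -[X in measurable X]setTI.
  exact: measurable_tnth.
congr (_ _); apply/seteqP; split => [[a t]/= At|[a t]/= [Aa At] i].
  split; first exact: (At ord0).
  by move=> i; have := At (lift ord0 i); rewrite tnthS.
by case: (unliftP ord0 i) => [j|] -> //; rewrite tnthS.
Qed.

End lebesgue_measure_tuple.

Section grids.
Context {R : realType} {d : nat}.
Local Notation T := (measurableTypeR R).
Implicit Types (g : 'M[R]_d) (x : set 'cV[R]_d) (v : 'cV[R]_d).

(* The lattice g Z^d; the columns of g form a basis. *)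
Definition int_span g : set 'cV[R]_d :=
  [set g *m map_mx intr z | z in [set: 'cV[int]_d]].

Definition translate x v : set 'cV[R]_d := [set w + v | w in x].

Definition differences (y : set 'cV[R]_d) : set 'cV[R]_d :=
  [set u - w | u in y & w in y].

Lemma int_span0 g : int_span g 0.
Proof. by exists 0 => //; rewrite map_mx0 mulmx0. Qed.

Lemma int_spanB g u w : int_span g u -> int_span g w -> int_span g (u - w).
Proof.
by move=> [a _ <-] [b _ <-]; exists (a - b) => //; rewrite map_mxB mulmxBr.
Qed.

Lemma differences_translate g v :
  differences (translate (int_span g) v) = int_span g.
Proof.
apply/seteqP; split => [_ [_ [u xu <-] [_ [w xw <-] <-]]|u xu].
  by rewrite opprD addrACA subrr addr0; exact: int_spanB.
exists (u + v); first by exists u.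
by exists (0 + v); [exists 0 => //; exact: int_span0|rewrite add0r addrK].
Qed.

End grids.

Section spaces.
Variables (R : realType) (d : nat).

(* X_d, as the orbit of Z^d under SL_d(R). *)
Record lattice := Lattice {
  lattice_set :> set 'cV[R]_d ;
  lattice_unimodular : exists2 g, \det g = 1 & lattice_set = int_span g }.

Record grid := Grid {
  grid_set :> set 'cV[R]_d ;
  grid_translate : exists (x : lattice) v, grid_set = translate x v }.

End spaces.

Section theory.
Context {R : realType} {d : nat}.
Local Notation T := (measurableTypeR R).
Implicit Types (x : lattice R d) (y : grid R d) (v : 'cV[R]_d).

Lemma lattice_inj x x' : x = x' :> set _ -> x = x'.
Proof.
case: x x' => [x hx] [x' hx'] /= xx'; subst x'.
by congr Lattice; exact: Prop_irrelevance.
Qed.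

Lemma grid_inj y y' : y = y' :> set _ -> y = y'.
Proof.
case: y y' => [x hx] [x' hx'] /= xx'; subst x'.
by congr Grid; exact: Prop_irrelevance.
Qed.

Lemma grid_pi_subproof y :
  exists2 g : 'M[R]_d, \det g = 1 & differences y = int_span g.
Proof.
have [[x [g g1 xg]] [v ->]] := grid_translate y.
by exists g; rewrite //= xg differences_translate.
Qed.

(* The lattice underlying a grid y = x + v is recovered from y alone as
   y - y, see grid_pi_translate. *)
Definition grid_pi y : lattice R d := Lattice (grid_pi_subproof y).

Definition lattice_translate x v : grid R d :=
  @Grid R d (translate x v)
    (ex_intro _ x (ex_intro _ v erefl)).

Lemma grid_pi_translate x v : grid_pi (lattice_translate x v) = x.
Proof.
apply: lattice_inj => /=; have [g _ ->] := lattice_unimodular x.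
exact: differences_translate.
Qed.

Definition fiber x := {y : grid R d | grid_pi y = x}.

Definition fiber_proj x v : fiber x :=
  exist _ (lattice_translate x v) (grid_pi_translate x v).

Lemma fiber_proj_surj x (y : fiber x) : exists v, fiber_proj x v = y.
Proof.
case: y => y yx; have [x' [v yv]] := grid_translate y.
exists v; apply: eq_exist => /=; apply: grid_inj => /=; rewrite yv -yx /=.
have [g _ xg] := lattice_unimodular x'.
by rewrite yv xg differences_translate.
Qed.

Lemma fiber_proj_eq x v v' :
  fiber_proj x v = fiber_proj x v' <-> lattice_set x (v - v').
Proof.
have [g _ xg] := lattice_unimodular x; split.
  move=> /(congr1 (fun y : fiber x => grid_set (sval y)))/= vv'.
  have : translate x v v by exists 0; rewrite ?xg ?add0r//; exact: int_span0.
  by rewrite vv' => -[w xw <-]; rewrite addrK.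
rewrite xg => xvv'; apply: eq_exist; apply: grid_inj => /=.
rewrite xg; apply/seteqP; split => _ [w xw <-].
  exists (w + (v - v')); last by rewrite -addrA subrK.
  rewrite -[v - v']opprK; apply: int_spanB => //.
  by rewrite -[X in int_span _ X]sub0r; apply: int_spanB => //; exact: int_span0.
exists (w - (v - v')); first exact: int_spanB.
by rewrite opprB -addrA subrK.
Qed.

Definition coordinate_product v : R := \prod_(i < d) v i 0.

Definition grid_values y : set R := coordinate_product @` y.

Definition minkowski_conjecture y : Prop :=
  grid_values y `&` `[- 2 ^- d, 2 ^- d] !=set0.

Definition vec (t : d.-tuple T) : 'cV[R]_d := \col_i tnth t i.

Definition fiber_display : measure_display. Proof. exact. Qed.

Section fiber_measurable.
Variable x : lattice R d.

(* The quotient sigma-algebra of R^d / x (Borel sets) under the identification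
   of fiber x with R^d / x given by fiber_proj_surj and fiber_proj_eq. *)
Definition fiber_measurable : set (set (fiber x)) :=
  image_set_system setT (fiber_proj x \o vec) measurable.

Let sigma_algebra_fiber : sigma_algebra setT fiber_measurable.
Proof. exact/sigma_algebra_image/sigma_algebra_measurable. Qed.

Let fiber0 : fiber_measurable set0.
Proof. by have [] := sigma_algebra_fiber. Qed.

Let fiberC A : fiber_measurable A -> fiber_measurable (~` A).
Proof. by rewrite -setTD; have [_ + _] := sigma_algebra_fiber; apply. Qed.

Let fiber_bigcup (F : (set (fiber x))^nat) :
  (forall i, fiber_measurable (F i)) -> fiber_measurable (\bigcup_i F i).
Proof. by have [_ _] := sigma_algebra_fiber; apply. Qed.

HB.instance Definition _ := gen_eqMixin (fiber x).
HB.instance Definition _ := gen_choiceMixin (fiber x).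
HB.instance Definition _ := isPointed.Build (fiber x) (fiber_proj x 0).
HB.instance Definition _ := @isMeasurable.Build fiber_display (fiber x)
  fiber_measurable fiber0 fiberC fiber_bigcup.

Lemma measurable_fiber_proj :
  measurable_fun [set: d.-tuple T] (fiber_proj x \o vec).
Proof. by move=> _ A. Qed.

(* A choice of basis; the measure fiber_measure below does not depend on it. *)
Definition lattice_basis : 'M[R]_d := projT1 (cid2 (lattice_unimodular x)).

Lemma det_lattice_basis : \det lattice_basis = 1.
Proof. by rewrite /lattice_basis; case: cid2. Qed.

Lemma int_span_lattice_basis : x = int_span lattice_basis :> set _.
Proof. by rewrite /lattice_basis; case: cid2. Qed.

Definition fundamental_domain : set 'cV[R]_d :=
  [set lattice_basis *m u | u in [set u : 'cV[R]_d | forall i, 0 <= u i 0 < 1]].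

Lemma measurable_fundamental_domain :
  measurable (vec @^-1` fundamental_domain).
Proof.
have gU : lattice_basis \in unitmx by rewrite unitmxE det_lattice_basis unitr1.
pose f i (t : d.-tuple T) : R := (invmx lattice_basis *m vec t) i 0.
have mf i : measurable_fun setT (f i).
  rewrite (_ : f i = fun t => \sum_(j < d) invmx lattice_basis i j * tnth t j).
    apply: measurable_sum => j; apply: measurable_funM => //.
    exact: (@measurable_tnth _ T).
  by apply/funext => t; rewrite /f mxE; apply: eq_bigr => j _; rewrite mxE.
rewrite (_ : _ @^-1` _ =
    \bigcap_(i in [set: 'I_d]) (setT `&` f i @^-1` `[0, 1[%classic)).
  by apply: fin_bigcap_measurable => // i _; apply: mf => //; exact: measurable_itv.
apply/seteqP; split => t /=.
  by move=> [u u01 gut] i _; split => //=; rewrite /f -gut mulKmx// in_itv/=.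
move=> ft; exists (invmx lattice_basis *m vec t); last by rewrite mulKVmx.
by move=> i; have [//= _] := ft i I; rewrite in_itv.
Qed.

(* Lebesgue measure on R^d / x: Lebesgue measure on R^d restricted to a
   fundamental domain and pushed forward to the quotient. *)
Definition fiber_measure : set (fiber x) -> \bar R :=
  pushforward (mrestr (@lebesgue_measure_tuple R d)
    measurable_fundamental_domain) (fiber_proj x \o vec).

HB.instance Definition _ := Measure.copy fiber_measure
  (measure_function_pushforward__canonical__measure_function_Measure
     (mrestr (@lebesgue_measure_tuple R d) measurable_fundamental_domain)
     measurable_fiber_proj).

End fiber_measurable.

End theory.

Arguments fiber_measure {R d} x _.

(* Main.v *)
Require Import Defs.
From mathcomp Require Import all_boot all_order all_algebra all_fingroup.
From mathcomp Require Import all_classical all_reals all_analysis.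
From mathcomp Require Import measurable_realfun.
From mathcomp Require Import zify ring lra.
Set Implicit Arguments.
Unset Strict Implicit.
Unset Printing Implicit Defensive.
Import Order.TTheory GRing.Theory Num.Theory.
Local Open Scope classical_set_scope.
Local Open Scope ring_scope.

(* For margins th_i > 0, call v bad if no point w of v + g Z^d satisfies
   prod_i (|w_i| + th_i) <= 2^-d |det g|.  By induction on d, the density of bad
   points tends to 0, uniformly over all lattices, as the margins become small
   compared with the length of the shortest lattice vector.  If some moderate
   diagonal stretching of the lattice has a large gap between two successive
   minima, the short vectors span a sublattice of rank r < d; the lattice then
   fibers over a lattice of rank d - r, both 2^-d and |det g| are multiplicative,
   and the gap absorbs the error of the splitting into the margins.  Otherwise
   all moderate diagonal stretchings have bounded shape, and counting grid points
   in stretched boxes inside {|N| <= 2^-d |det g|} gives asymptotically uncorrelated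
   functions, so that almost every grid meets one of these boxes.

   Density is measured by averages over finitely many translates, uniformly in
   the base point.  This passes to fibers and to change of bases without any
   measurability, and bounds the Lebesgue measure of periodic sets at the end. *)

(** * Uniform upper means *)

(** The constant [2 ^- d] comes from dimension one, where 1/2 is the exact covering radius of the
    integers; higher ranks inherit it by multiplicativity. A box with side product at most
    [2 ^- d * |det g|] contains on average at most [2 ^- d] grid points, so a single box misses many
    grids. No pigeonhole argument can help, and a second moment over many boxes takes its place. The
    margins do double duty in the fibration. A small product alone allows one huge coordinate, and
    the coupling [K] between the two groups of coordinates would then spoil the other factor. A
    positive margin in every factor bounds each coordinate separately, and behind a large gap the
    margin of the quotient exceeds that bound. Uniformity over all lattices is forced: of the
    sublattice, the quotient and the stretched lattices, little more than a lower bound on the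
    shortest vector is under control. Covolumes are not normalized, and margins are measured against
    the shortest vector, which makes the estimate invariant under scaling. *)

Lemma eq_ler (R : numDomainType) (a b : R) : a = b -> a <= b.
Proof. by move=> ->. Qed.

Lemma sumr_const_seq (R : pzRingType) I (s : seq I) (a : R) :
  \sum_(t <- s) a = a * (size s)%:R.
Proof. by rewrite big_const_seq count_predT iter_addr_0 mulr_natr. Qed.

Section upper_mean.
Context {R : realType} {V : zmodType}.
Implicit Types (f : V -> R) (s : seq V) (c : R).

(* The least such [c] is the largest value at [f] of a translation invariant mean. *)
Definition umean f c := forall e : R, 0 < e ->
  exists2 s, s != [::] & forall v, \sum_(t <- s) f (v + t) <= (c + e) * (size s)%:R.

Lemma umean_le f f' c c' : (forall v, f v <= f' v) -> c' <= c ->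
  umean f' c' -> umean f c.
Proof.
move=> ff' cc' uf e e0; have [s s0 sf] := uf e e0.
exists s => // v; apply: le_trans (ler_sum _ (fun t _ => ff' (v + t))) _.
by apply: le_trans (sf v) _; rewrite ler_wpM2r// lerD2r.
Qed.

(** The sumset of the two averaging lists serves both functions: with the element of the other list
    fixed, each function is averaged over its own list from a displaced base point, and the bounds
    are uniform in the base point. *)
Lemma umeanD f f' c c' : umean f c -> umean f' c' ->
  umean (fun v => f v + f' v) (c + c').
Proof.
move=> uf uf' e e0; have e20 : 0 < e / 2 by rewrite divr_gt0.
have [s s0 sf] := uf _ e20; have [s' s'0 sf'] := uf' _ e20.
exists [seq x + y | x <- s, y <- s'].
  by rewrite -size_eq0 size_allpairs muln_eq0 !size_eq0 negb_or s0.
move=> v; rewrite big_split/= size_allpairs natrM.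
have -> : (c + c' + e) * ((size s)%:R * (size s')%:R) =
  (c + e / 2) * (size s)%:R * (size s')%:R +
  (c' + e / 2) * (size s')%:R * (size s)%:R by field.
apply: lerD.
- rewrite big_allpairs_dep exchange_big/=.
  apply: (@le_trans _ _ (\sum_(t <- s') (c + e / 2) * (size s)%:R)).
    apply: ler_sum => t _; apply: le_trans (sf (v + t)).
    by apply/eq_ler/eq_bigr => u _; rewrite addrAC addrA.
  by rewrite sumr_const_seq.
- rewrite big_allpairs_dep/=.
  apply: (@le_trans _ _ (\sum_(t <- s) (c' + e / 2) * (size s')%:R)).
    apply: ler_sum => t _; apply: le_trans (sf' (v + t)).
    by apply/eq_ler/eq_bigr => u _; rewrite addrA.
  by rewrite sumr_const_seq.
Qed.

Lemma umean_cst c : umean (fun=> c) c.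
Proof.
move=> e e0; exists [:: 0] => // v; rewrite big_seq1 mulr1.
by rewrite lerDl ltW.
Qed.

Lemma umeanZ k f c : 0 <= k -> umean f c -> umean (fun v => k * f v) (k * c).
Proof.
rewrite le_eqVlt => /predU1P[<- _|k0 uf].
  rewrite mul0r; apply: umean_le (umean_cst 0) => // v.
  by rewrite mul0r.
move=> e e0; have [s s0 sf] := uf (e / k) (divr_gt0 e0 k0).
exists s => // v; rewrite -mulr_sumr -ler_pdivlMl//.
apply: le_trans (sf v) _; rewrite mulrA ler_wpM2r//.
by rewrite mulrDr mulKf ?gt_eqF// mulrC.
Qed.

Lemma umean_sum I (r : seq I) (f : I -> V -> R) (c : I -> R) :
  (forall i, umean (f i) (c i)) ->
  umean (fun v => \sum_(i <- r) f i v) (\sum_(i <- r) c i).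
Proof.
move=> uf; elim: r => [|i r ih].
  rewrite big_nil; apply: umean_le (umean_cst 0) => // v.
  by rewrite big_nil.
rewrite big_cons; apply: umean_le (umeanD (uf i) ih) => // v.
by rewrite big_cons.
Qed.

Lemma umean_ge f c a : umean f c -> (forall v, a <= f v) -> a <= c.
Proof.
move=> uf af; apply/ler_addgt0Pr => e e0; have [s s0 sf] := uf e e0.
have n0 : 0 < (size s)%:R :> R by rewrite ltr0n lt0n size_eq0.
rewrite -(ler_pM2r n0); apply: le_trans (sf 0).
apply: (@le_trans _ _ (\sum_(t <- s) a)); last exact: ler_sum.
by rewrite big_const_seq count_predT iter_addr_0 mulr_natr.
Qed.

Lemma umean_shift f c t : umean f c -> umean (fun v => f (v + t)) c.
Proof.
move=> uf e e0; have [s s0 sf] := uf e e0; exists s => // v.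
apply: le_trans (sf (v + t)); apply/eq_ler/eq_bigr => u _.
by rewrite addrAC.
Qed.

Lemma umean_closed f c : (forall e, 0 < e -> umean f (c + e)) -> umean f c.
Proof.
move=> uf e e0; have e20 : 0 < e / 2 by rewrite divr_gt0.
have [s s0 sf] := uf _ e20 _ e20; exists s => // v.
by apply: le_trans (sf v) _; rewrite -addrA -splitr.
Qed.

(** Upper and lower means agree, so [c] is the value of every translation invariant mean at [f].
    This stands in for the integral over the torus. *)
Definition mean f c := umean f c /\ umean (fun v => - f v) (- c).

Lemma mean_ext f f' c : f =1 f' -> mean f c -> mean f' c.
Proof. by move=> /funext ->. Qed.

Lemma mean_cst c : mean (fun=> c) c.
Proof. by split; exact: umean_cst. Qed.

Lemma mean_sum I (r : seq I) (f : I -> V -> R) (c : I -> R) :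
  (forall i, mean (f i) (c i)) ->
  mean (fun v => \sum_(i <- r) f i v) (\sum_(i <- r) c i).
Proof.
move=> uf; split; first by apply: umean_sum => i; have [] := uf i.
rewrite -sumrN; apply: (@umean_le _ (fun v => \sum_(i <- r) - f i v)) (lexx _) _.
  by move=> v; rewrite sumrN.
by apply: umean_sum => i; have [] := uf i.
Qed.

Lemma mean_shift f c t : mean f c -> mean (fun v => f (v + t)) c.
Proof. by move=> [uf lf]; split; [exact: umean_shift|exact: umean_shift lf]. Qed.

Lemma umean_mean_le f f' c c' : (forall v, f v <= f' v) ->
  mean f c -> umean f' c' -> c <= c'.
Proof.
move=> ff' [_ lf] uf'; rewrite -subr_ge0.
apply: (umean_ge (umeanD uf' lf)) => v; rewrite subr_ge0; exact: ff'.
Qed.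

Lemma mean_uniq f c c' : mean f c -> mean f c' -> c = c'.
Proof.
move=> mf mf'; apply/eqP; rewrite eq_le; apply/andP; split.
  exact: (umean_mean_le (fun=> lexx _) mf (proj1 mf')).
exact: (umean_mean_le (fun=> lexx _) mf' (proj1 mf)).
Qed.

(** Chebyshev's inequality. On [E] the sum of the [f i / m - 1] equals [- n], so its square is
    [n ^ 2]; expanding the square, the hypotheses bound its upper mean by the sum of the [y i j]. *)
Lemma umean_second_moment n (f : 'I_n -> V -> R) (E : set V) m (y : 'I_n -> 'I_n -> R) :
  (0 < n)%N -> 0 < m -> (forall i, mean (f i) m) ->
  (forall i j, umean (fun v => f i v * f j v) (m ^+ 2 * (1 + y i j))) ->
  (forall v, E v -> forall i, f i v = 0) ->
  umean (fun v => (v \in E)%:R) ((\sum_i \sum_j y i j) / n%:R ^+ 2).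
Proof.
move=> n0 m0 mf ufj E0; have nn : 0 < n%:R :> R by rewrite ltr0n.
pose G v := \sum_i \sum_j ((m ^- 2 * (f i v * f j v)) +
  (m^-1 * - f i v + m^-1 * - f j v + 1)).
have GE v : G v = (\sum_i (m^-1 * f i v - 1)) ^+ 2.
  rewrite expr2 mulr_suml; apply: eq_bigr => i _; rewrite mulr_sumr.
  by apply: eq_bigr => j _; field; rewrite gt_eqF.
have uG : umean G (\sum_i \sum_j y i j).
  apply: umean_sum => i; apply: umean_sum => j.
  have -> : y i j = m ^- 2 * (m ^+ 2 * (1 + y i j)) +
    (m^-1 * - m + m^-1 * - m + 1) by field; rewrite gt_eqF.
  have [_ li] := mf i; have [_ lj] := mf j.
  apply: umeanD; first by apply: umeanZ => //; rewrite invr_ge0 exprn_ge0 ?ltW.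
  by apply: umeanD (umean_cst 1); apply: umeanD; apply: umeanZ => //; rewrite invr_ge0 ltW.
have n20 : 0 <= (n%:R ^+ 2)^-1 :> R by rewrite invr_ge0 exprn_ge0 ?ltW.
rewrite mulrC; apply: umean_le (umeanZ n20 uG) => // v.
have [/set_mem Ev|nE] := boolP (v \in E); last first.
  by rewrite GE; apply: mulr_ge0 => //; exact: sqr_ge0.
rewrite GE (eq_bigr (fun=> -1)) => [|i _]; last by rewrite E0// mulr0 sub0r.
by rewrite sumrN sumr_const card_ord sqrrN mulVf// expf_neq0// gt_eqF.
Qed.

End upper_mean.

(** Averaging translations of [W] are lifted through [psi]. The map [phi] may be far from additive:
    it has to be equivariant only along the image of [psi], and only as seen by [F]. *)
Lemma umean_pull {R : realType} (V W : zmodType) (F : W -> R) (c : R)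
    (phi : V -> W) (psi : W -> V) :
  (forall v s, F (phi (v + psi s)) = F (phi v + s)) ->
  umean F c -> umean (F \o phi) c.
Proof.
move=> FE uF e e0; have [s s0 sF] := uF e e0.
exists (map psi s) => [|v]; first by rewrite -size_eq0 size_map size_eq0.
by rewrite size_map big_map; apply: le_trans (sF (phi v)); apply/eq_ler/eq_bigr => t _; exact: FE.
Qed.

(** * Sums over grids *)

Definition lat {R : realType} {d e : nat} (g : 'M[R]_(d, e)) (z : 'cV[int]_e) : 'cV[R]_d :=
  g *m map_mx intr z.

Lemma latD {R : realType} d e (g : 'M[R]_(d, e)) z w : lat g (z + w) = lat g z + lat g w.
Proof. by rewrite /lat map_mxD mulmxDr. Qed.

Lemma latN {R : realType} d e (g : 'M[R]_(d, e)) z : lat g (- z) = - lat g z.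
Proof. by rewrite /lat map_mxN mulmxN. Qed.

Lemma lat0 {R : realType} d e (g : 'M[R]_(d, e)) : lat g 0 = 0.
Proof. by rewrite /lat map_mx0 mulmx0. Qed.

Lemma finite_int_box d (N : nat) :
  finite_set [set z : 'cV[int]_d | forall i, `|z i 0| <= N%:Z].
Proof.
apply: (@sub_finite_set _ _ ((fun f : {ffun 'I_d -> 'I_(N + N).+1} =>
  \col_i ((f i)%:Z - N%:Z)) @` setT)); last exact/finite_image/finite_finset.
move=> z /= zN.
exists [ffun i => inord (absz (z i 0 + N%:Z))] => //.
apply/matrixP => i j; rewrite ord1 mxE ffunE inordK.
  have := zN i; rewrite ler_norml => /andP[zl zu].
  by rewrite gez0_abs ?addrK// addrC -lerBlDl sub0r.
have := zN i; rewrite ler_norml => /andP[zl zu].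
by rewrite ltnS -lez_nat gez0_abs 1?addrC -?lerBlDl ?sub0r// PoszD lerD2l.
Qed.

Section counting.
Context {R : realType} {d : nat}.
Implicit Types (g : 'M[R]_d) (F : 'cV[R]_d -> R) (v p : 'cV[R]_d) (l : 'I_d -> R).

Lemma finite_lat_ball g v K : g \in unitmx ->
  finite_set [set z | forall i, `|(v + lat g z) i 0| <= K].
Proof.
move=> gU; pose N := Num.truncn (\sum_i \sum_j `|invmx g i j| * (K + `|v j 0|)).
apply: sub_finite_set (@finite_int_box d N.+1) => z /= zK i.
rewrite -(@ler_int R) intr_norm.
have -> : (z i 0)%:~R = \sum_j invmx g i j * ((v + lat g z) j 0 - v j 0) :> R.
  have -> : (z i 0)%:~R = (invmx g *m (lat g z)) i 0.
    by rewrite /lat mulKmx// mxE.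
  by rewrite mxE; apply: eq_bigr => j _; rewrite [in RHS]mxE [X in _ * (X - _)]addrC addrK.
apply: le_trans (ler_norm_sum _ _ _) _.
apply: (@le_trans _ _ (\sum_i \sum_j `|invmx g i j| * (K + `|v j 0|))); last first.
  by apply: ltW; rewrite -pmulrn; exact: truncnS_gt.
have Kv j : `|(v + lat g z) j 0 - v j 0| <= K + `|v j 0|.
  by apply: le_trans (ler_normB _ _) _; rewrite lerD2r zK.
rewrite [leRHS](bigD1 i)//= -[leLHS]addr0; apply: lerD.
  by apply: ler_sum => j _; rewrite normrM ler_wpM2l.
apply: sumr_ge0 => k _; apply: sumr_ge0 => j _; rewrite mulr_ge0//.
exact: le_trans (normr_ge0 _) (Kv j).
Qed.

Definition bounded_support F K := forall u, F u != 0 -> forall i, `|u i 0| <= K.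

(** The periodization of [F]. A sum of infinite support would be 0 by convention; [bounded_support]
    together with an invertible [g] excludes this. *)
Definition lattice_sum g F v : R := \sum_(z \in [set: 'cV[int]_d]) F (v + lat g z).

Lemma lattice_sum_seq g F v (r : seq 'cV[int]_d) : uniq r ->
  (forall z, F (v + lat g z) != 0 -> z \in r) ->
  lattice_sum g F v = \sum_(z <- r) F (v + lat g z).
Proof.
move=> ur Fr; rewrite /lattice_sum (@fsbigE _ _ _ _ _ r)//.
  by apply: eq_bigl => z; rewrite in_setT.
by move=> z _ zr; apply/eqP; apply: contraNT zr; exact: Fr.
Qed.

Lemma lat_ball_seq g v K : g \in unitmx -> exists2 r : seq 'cV[int]_d, uniq r &
  forall z, (forall i, `|(v + lat g z) i 0| <= K) -> z \in r.
Proof.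
move=> gU; have /finite_seqP[r rE] := finite_lat_ball v K gU.
exists (undup r) => [|z zK]; first exact: undup_uniq.
rewrite mem_undup; suff : [set` r] z by [].
by rewrite -rE.
Qed.

Lemma lattice_sum_lat g F v w : lattice_sum g F (v + lat g w) = lattice_sum g F v.
Proof.
rewrite [RHS]/lattice_sum (@reindex_fsbigT _ _ _ _ _ (fun z => w + z)).
  by rewrite /lattice_sum; apply: eq_fsbigr => z _; rewrite latD addrA.
by exists (fun z => z - w) => z; rewrite addrC ?addKr ?addrNK // addrA addrNK addrC addrK.
Qed.

Lemma lattice_sum_le g F F' K K' v v' w : g \in unitmx ->
  bounded_support F K -> bounded_support F' K' ->
  (forall z, F (v + lat g z) <= F' (v' + lat g (w + z))) ->
  lattice_sum g F v <= lattice_sum g F' v'.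
Proof.
move=> gU FK FK' FF'; rewrite -(lattice_sum_lat g F' v' w).
have [r ur rP] := lat_ball_seq v K gU.
have [r' ur' rP'] := lat_ball_seq (v' + lat g w) K' gU.
have us : uniq (undup (r ++ r')) by exact: undup_uniq.
rewrite !(lattice_sum_seq us) => [|z Fz|z Fz]; last first.
- by rewrite mem_undup mem_cat rP//; exact: FK.
- by rewrite mem_undup mem_cat rP' ?orbT//; exact: FK'.
by apply: ler_sum => z _; rewrite -addrA -latD.
Qed.

Lemma lattice_sum_ge g F K v z : g \in unitmx -> bounded_support F K ->
  (forall u, 0 <= F u) -> F (v + lat g z) <= lattice_sum g F v.
Proof.
move=> gU FK F0; have [r ur rP] := lat_ball_seq v K gU.
have us : uniq (undup (z :: r)) by exact: undup_uniq.
rewrite (lattice_sum_seq us) => [|w Fw]; last first.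
  by rewrite mem_undup in_cons rP ?orbT//; exact: FK.
have zs : z \in undup (z :: r) by rewrite mem_undup mem_head.
by rewrite (bigD1_seq z zs us)/= lerDl sumr_ge0.
Qed.

Lemma lattice_sum_ge0 g F K v : g \in unitmx -> bounded_support F K ->
  (forall u, 0 <= F u) -> 0 <= lattice_sum g F v.
Proof. by move=> gU FK F0; apply: le_trans (lattice_sum_ge v 0 gU FK F0). Qed.

Lemma lattice_sum_sum g I (s : seq I) (F : I -> 'cV[R]_d -> R) K v : g \in unitmx ->
  (forall k, bounded_support (F k) K) ->
  lattice_sum g (fun u => \sum_(k <- s) F k u) v = \sum_(k <- s) lattice_sum g (F k) v.
Proof.
move=> gU FK; have [r ur rP] := lat_ball_seq v K gU.
rewrite (lattice_sum_seq ur) => [|z]; last first.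
  apply: contraNT => zr; apply/eqP; rewrite big1// => k _; apply/eqP.
  by apply: contraNT zr => /FK/rP.
rewrite exchange_big/=; apply: eq_bigr => k _; apply/esym.
by apply: lattice_sum_seq => // z /FK/rP.
Qed.

(** Pairs of grid points are sorted by their difference, a lattice vector of size at most [K + K'].
    The list [W] of differences does not depend on [v], so means can be taken term by term. *)
Lemma lattice_sum_mul g F F' K K' v (W : seq 'cV[int]_d) : g \in unitmx ->
  bounded_support F K -> bounded_support F' K' -> uniq W ->
  (forall w, (forall i, `|lat g w i 0| <= K + K') -> w \in W) ->
  lattice_sum g F v * lattice_sum g F' v =
    \sum_(w <- W) lattice_sum g (fun u => F u * F' (u + lat g w)) v.
Proof.
move=> gU FK FK' uW WP; have [r ur rP] := lat_ball_seq v K gU.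
rewrite (lattice_sum_seq ur) => [|z /FK/rP//]; rewrite mulr_suml.
rewrite [RHS](eq_bigr (fun w => \sum_(z <- r)
    F (v + lat g z) * F' (v + lat g z + lat g w))); last first.
  move=> w _; rewrite (lattice_sum_seq ur)// => z; rewrite mulf_eq0 negb_or.
  by move=> /andP[/FK/rP].
rewrite [RHS]exchange_big/=; apply: eq_bigr => z _; rewrite -mulr_sumr.
have [->|/FK Fz] := eqVneq (F (v + lat g z)) 0; first by rewrite !mul0r.
congr (_ * _); rewrite -(lattice_sum_lat g F' v z); apply: lattice_sum_seq => // w /FK' Fw.
apply: WP => i.
have -> : lat g w i 0 = (v + lat g z + lat g w) i 0 - (v + lat g z) i 0.
  by rewrite [X in X - _]mxE addrC addrK.
by apply: le_trans (ler_normB _ _) _; rewrite addrC lerD.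
Qed.

End counting.

(** * Counting grid points in boxes *)

Section boxes.
Context {R : realType} {d : nat}.
Implicit Types (g : 'M[R]_d) (u v p t : 'cV[R]_d) (l e : 'I_d -> R) (n k : 'I_d -> nat).

(** Half open, so that translates tile a larger box exactly. *)
Definition box p l u : R := \prod_i (p i 0 <= u i 0 < p i 0 + l i)%R%:R.

Lemma box_ge0 p l u : 0 <= box p l u.
Proof. by apply: prodr_ge0 => i _; exact: ler0n. Qed.

Lemma box1 p l u : (forall i, p i 0 <= u i 0 < p i 0 + l i) -> box p l u = 1.
Proof. by move=> h; rewrite /box big1// => i _; rewrite h. Qed.

Lemma box_neq0 p l u : box p l u != 0 -> forall i, p i 0 <= u i 0 < p i 0 + l i.
Proof.
by move=> h i; move: h; apply: contraNT => /negbTE h; rewrite /box (bigD1 i)//= h mul0r.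
Qed.

Lemma box_leP p l u a : (0 <= a) ->
  ((forall i, p i 0 <= u i 0 < p i 0 + l i) -> 1 <= a) -> box p l u <= a.
Proof.
move=> a0 h; have [->//|/box_neq0 b] := eqVneq (box p l u) 0.
by rewrite box1// h.
Qed.

Lemma bounded_box p l : bounded_support (box p l) (\sum_i (`|p i 0| + `|l i|)).
Proof.
move=> u /box_neq0 b i; rewrite (bigD1 i)//=.
have s0 : 0 <= \sum_(j | j != i) (`|p j 0| + `|l j|).
  by apply: sumr_ge0 => j _; rewrite addr_ge0.
have /andP[b1 b2] := b i.
have := ler_norm (p i 0); have := ler_norm (- p i 0); have := ler_norm (l i).
rewrite normrN ler_norml => *; apply/andP; split; lra.
Qed.

Lemma box_shift p l u t : box p l (u + t) = box (p - t) l u.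
Proof.
apply: eq_bigr => i _; rewrite !mxE; congr (_%:R).
by rewrite lerBlDr addrAC ltrBrDr.
Qed.

Lemma lattice_sum_box_shift g p l v t :
  lattice_sum g (box p l) (v + t) = lattice_sum g (box (p - t) l) v.
Proof. by apply: eq_fsbigr => z _; rewrite addrAC [LHS]box_shift. Qed.

Lemma sum_itv_tile (a x y : R) m : 0 <= y ->
  \sum_(j < m) (a + j%:R * y <= x < a + j%:R * y + y)%R%:R =
  (a <= x < a + m%:R * y)%R%:R :> R.
Proof.
move=> y0; elim: m => [|m ih].
  by rewrite big_ord0 mul0r addr0 le_lt_asym.
rewrite big_ord_recr/= ih -addn1 natrD mulrDl mul1r addrA.
have my : 0 <= m%:R * y by rewrite mulr_ge0.
case: (leP a x) => ax /=; last first.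
  by rewrite leNgt (lt_le_trans ax)// ?lerDl// addr0.
case: (leP (a + m%:R * y) x) => axm /=; first by rewrite add0r.
by rewrite (lt_le_trans axm) ?lerDl// addr0.
Qed.

Lemma box_tile l n : (forall i, 0 <= l i) ->
  exists2 s : seq 'cV[R]_d, size s = (\prod_i n i)%N &
  forall p u, box p (fun i => (n i)%:R * l i) u = \sum_(t <- s) box (p + t) l u.
Proof.
move=> l0; pose N := \max_i n i.
have nN i : (n i <= N)%N by exact: leq_bigmax.
pose Q i := [pred j : 'I_N | (j < n i)%N].
exists [seq \col_i ((f i : 'I_N)%:R * l i) | f : {ffun 'I_d -> 'I_N} in family Q].
  rewrite size_map -cardE card_family foldrE big_image/=.
  apply: eq_bigr => i _; rewrite -sum1_card.
  rewrite -(big_ord_widen_cond N predT (fun=> 1%N))//.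
  by rewrite sum1_card card_ord.
move=> p u; rewrite big_map big_enum/= /box.
under eq_bigr => i _ do rewrite -sum_itv_tile//.
under eq_bigr => i _ do rewrite (big_ord_widen N
  (fun j => (p i 0 + j%:R * l i <= u i 0 < p i 0 + j%:R * l i + l i)%R%:R))//.
rewrite bigA_distr_big_dep/=; apply: eq_bigr => f _.
by apply: eq_bigr => i _; rewrite !mxE.
Qed.

End boxes.

Lemma bernoulli_ineq (R : realDomainType) (x : R) m :
  0 <= x <= 1 -> 1 - m%:R * x <= (1 - x) ^+ m.
Proof.
move=> /andP[x0 x1]; elim: m => [|m ih]; first by rewrite mul0r subr0.
rewrite exprS; apply: le_trans (ler_wpM2l _ ih); last by rewrite subr_ge0.
have : 0 <= m%:R * x * x by rewrite !mulr_ge0.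
by rewrite -natr1; lra.
Qed.

Section box_means.
Context {R : realType} {d : nat}.
Implicit Types (g : 'M[R]_d) (u v p t : 'cV[R]_d) (l e : 'I_d -> R) (n k : 'I_d -> nat).

Definition covers g e :=
  forall v, exists z, forall i, 0 <= (v + lat g z) i 0 <= e i.

Lemma covers_le g e e' : (forall i, e i <= e' i) -> covers g e -> covers g e'.
Proof.
move=> ee' ge v; have [z zv] := ge v; exists z => i.
by have /andP[-> h] := zv i; rewrite (le_trans h).
Qed.

Lemma covers_ball g e :
  (forall v, exists z, forall i, `|(v + lat g z) i 0| <= e i) -> covers g (fun i => e i *+ 2).
Proof.
move=> h v; have [z zv] := h (v - \col_i e i); exists z => i.
by have := zv i; rewrite !mxE ler_norml => /andP[? ?]; apply/andP; split; lra.
Qed.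

Lemma covers_unit g : g \in unitmx -> covers g (fun i => (\sum_j `|g i j|) *+ 2).
Proof.
move=> gU; apply: (@covers_ball g (fun i => \sum_j `|g i j|)) => v.
exists (- \col_j Num.floor ((invmx g *m v) j 0)) => i.
rewrite latN -{1}[v](mulKVmx gU) /lat -mulmxBr mxE.
apply: le_trans (ler_norm_sum _ _ _) _; apply: ler_sum => j _.
rewrite normrM ler_piMr// !mxE ler_norml.
set x := \sum_(_ <- _ | _) _; have := floor_le x; have := floorD1_gt x.
rewrite intrD => *; apply/andP; split; lra.
Qed.

(** Modulo the lattice, [v' - v] lies in the box with sides [e]; enlarging the box by [e] absorbs
    this displacement. *)
Lemma lattice_sum_box_le g l e p v v' : g \in unitmx -> covers g e ->
  lattice_sum g (box p l) v <= lattice_sum g (box p (fun i => l i + e i)) v'.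
Proof.
move=> gU ge; have [w wv] := ge (v' - v).
apply: (lattice_sum_le (w := w) gU (@bounded_box _ _ _ _) (@bounded_box _ _ _ _)) => z.
apply: box_leP => [|b]; first exact: box_ge0.
rewrite box1// => i; have := b i; have := wv i.
rewrite latD !mxE => /andP[? ?] /andP[? ?]; apply/andP; split; lra.
Qed.

Lemma lattice_sum_box_tile g l n : g \in unitmx -> (forall i, 0 <= l i) ->
  exists2 s : seq 'cV[R]_d, size s = (\prod_i n i)%N &
  forall p v, lattice_sum g (box p (fun i => (n i)%:R * l i)) v =
    \sum_(t <- s) lattice_sum g (box p l) (v - t).
Proof.
move=> gU l0; have [s sn sP] := box_tile n l0; exists s => // p v.
pose K := \sum_(t <- s) \sum_i (`|(p + t) i 0| + `|l i|).
have -> : box p (fun i => (n i)%:R * l i) =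
    fun u => \sum_(t <- s) (fun t u => if t \in s then box (p + t) l u else 0) t u.
  by apply/funext => u; rewrite sP; apply: eq_big_seq => t ->.
rewrite (@lattice_sum_sum _ _ _ _ _ _ K)//; last first.
  move=> t u /=; case: ifPn => [ts|_]; last by rewrite eqxx.
  move=> /bounded_box b i; apply: le_trans (b i) _.
  rewrite /K (big_rem t ts)/= lerDl; apply: sumr_ge0 => t' _.
  by apply: sumr_ge0 => j _; rewrite addr_ge0.
by apply: eq_big_seq => t ts; rewrite ts lattice_sum_box_shift opprK.
Qed.

Lemma umean_tile (f f' : 'cV[R]_d -> R) (s : seq 'cV[R]_d) c : s != [::] ->
  (forall v, f' v = \sum_(t <- s) f (v - t)) -> (forall v, f' v <= c * (size s)%:R) ->
  umean f c.
Proof.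
move=> s0 f'E f'c e e0; exists (map -%R s).
  by rewrite -size_eq0 size_map size_eq0.
move=> v; rewrite size_map big_map -f'E; apply: le_trans (f'c v) _.
by rewrite ler_wpM2r// lerDl ltW.
Qed.

(* A large box is both a disjoint union of translates of the given one and, by [ge],
   contains about as many points of any grid as of any other. *)
Lemma lattice_sum_box_mean_pos g l : g \in unitmx -> (forall i, 0 < l i) ->
  exists h, mean (lattice_sum g (box 0 l)) h.
Proof.
move=> gU l0; have l0' i : 0 <= l i by exact/ltW.
pose f := lattice_sum g (box 0 l); pose fN N := lattice_sum g (box 0 (fun i => N%:R * l i)).
have [k ge] : exists k : nat, covers g (fun i => k%:R * l i).
  exists (\max_i (Num.truncn ((\sum_j `|g i j|) *+ 2 / l i)).+1).
  apply: covers_le (covers_unit gU) => i; rewrite -ler_pdivrMr//.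
  apply/ltW/(lt_le_trans (truncnS_gt _)); rewrite ler_nat.
  exact: (leq_bigmax (F := fun i => (Num.truncn ((\sum_j `|g i j|) *+ 2 / l i)).+1)).
have fNle N v v' : fN N v <= fN (N + k)%N v'.
  apply: le_trans (lattice_sum_box_le _ _ _ _ gU ge) _.
  by apply/eq_ler; congr (lattice_sum _ (box _ _) _); apply/funext => i; rewrite natrD mulrDl.
have tile N : exists2 s : seq 'cV[R]_d, size s = (N ^ d)%N &
    forall v, fN N v = \sum_(t <- s) f (v - t).
  have [s ss sP] := lattice_sum_box_tile (fun=> N) gU l0'; exists s.
    by rewrite ss prod_nat_const card_ord.
  by move=> v; exact: sP.
have ss0 N (s : seq 'cV[R]_d) : size s = (N.+1 ^ d)%N -> s != [::].
  by move=> ss; rewrite -size_eq0 ss expn_eq0.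
have f0 v : 0 <= f v by apply: lattice_sum_ge0 gU (@bounded_box _ _ _ _) _ => u; exact: box_ge0.
pose C := [set c | umean f c].
have C0 c : C c -> 0 <= c by move=> uc; exact: (umean_ge uc).
have NC N v : C (fN (N.+1 + k)%N v / (N.+1 ^ d)%:R).
  have [s ss sP] := tile N.+1; apply: umean_tile (ss0 _ _ ss) sP _ => v'.
  by rewrite ss divfK ?pnatr_eq0 ?expn_eq0.
have hC : has_inf C.
  by split; [exists (fN (1 + k)%N 0 / (1 ^ d)%:R); exact: NC|exists 0 => c /C0].
have infC c : C c -> inf C <= c by move=> Cc; apply: ge_inf => //; case: hC.
exists (inf C); split.
  apply: umean_closed => e e0; have [c Cc ce] := inf_adherent e0 hC.
  by apply: umean_le (ltW ce) Cc.
apply: umean_closed => e e0; set h := inf C in infC *.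
have h0 : 0 <= h by apply: lb_le_inf => //; case: hC.
have [N hN] : exists N : nat, h - h * (N.+1%:R / (N.+1 + k)%:R) ^+ d <= e.
  exists (Num.truncn (h * d%:R * k%:R / e)).
  set N := Num.truncn _; have := truncnS_gt (h * d%:R * k%:R / e); rewrite -/N.
  rewrite ltr_pdivrMr// => Nlt.
  pose x : R := k%:R / (N.+1 + k)%:R.
  have Nk0 : 0 < (N.+1 + k)%:R :> R by rewrite ltr0n.
  have xE : N.+1%:R / (N.+1 + k)%:R = 1 - x.
    apply: (mulIf (lt0r_neq0 Nk0)).
    by rewrite /x mulrBl !divfK ?gt_eqF// mul1r natrD addrK.
  have x01 : 0 <= x <= 1.
    by rewrite /x divr_ge0//= ler_pdivrMr// mul1r ler_nat leq_addl.
  have := ler_wpM2l h0 (bernoulli_ineq d x01).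
  rewrite xE => ?; apply: (@le_trans _ _ (h * (d%:R * x))).
    lra.
  rewrite /x !mulrA ler_pdivrMr//; apply/ltW/(lt_le_trans Nlt).
  by rewrite mulrC ler_pM2l// ler_nat leq_addr.
have [s ss sP] := tile (N + k).+1.
apply: (umean_tile (s := s) (f' := fun v => - fN (N + k).+1 v)) => [|v|v].
- exact: ss0 ss.
- by rewrite sP sumrN.
(* The count in the enlarged box, divided by [N.+1 ^ d], is an upper mean of [f], hence at least the
   infimum [h]. This is a lower bound at every [v], and it costs only the factor
   [(N.+1 / (N.+1 + k)) ^ d] chosen close to 1. *)
have := infC _ (NC N v); rewrite addSn ler_pdivlMr ?ltr0n ?expn_gt0// => hf.
rewrite ss lerNl; apply: le_trans hf; rewrite !natrX -mulNr opprD opprK.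
rewrite -ler_pdivlMr ?exprn_gt0// -mulrA -expr_div_n.
by rewrite addSn in hN; lra.
Qed.

(** Nonpositive sides give an empty box with mean 0. They do occur: two disjoint boxes intersect in
    a box whose formal side lengths may be negative. *)
Lemma lattice_sum_box_mean g l : g \in unitmx ->
  exists h, forall p, mean (lattice_sum g (box p l)) h.
Proof.
move=> gU; have [l0|] := pselect (forall i, 0 < l i).
  have [h mh] := lattice_sum_box_mean_pos gU l0; exists h => p.
  apply: mean_ext (mean_shift (- p) mh) => v.
  by rewrite lattice_sum_box_shift sub0r opprK.
move=> /existsNP[i /negP]; rewrite -leNgt => li.
exists 0 => p; apply: mean_ext (mean_cst 0) => v; rewrite /lattice_sum fsbig1// => z _.
apply/eqP; apply/negPn/negP => /box_neq0 => /(_ i).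
by move=> /andP[a b]; have := le_lt_trans a b; rewrite ltrDl ltNge li.
Qed.

Lemma mean_box_scale g l n h : g \in unitmx -> (forall i, 0 <= l i) ->
  (forall p, mean (lattice_sum g (box p l)) h) ->
  forall p, mean (lattice_sum g (box p (fun i => (n i)%:R * l i))) (\prod_i (n i)%:R * h).
Proof.
move=> gU l0 mh p; have [s ss sP] := lattice_sum_box_tile n gU l0.
apply: mean_ext (fun v => esym (sP p v)) _.
have -> : \prod_i (n i)%:R * h = \sum_(t <- s) h.
  by rewrite sumr_const_seq ss natr_prod mulrC.
by apply: mean_sum => t; apply: mean_shift.
Qed.

(** The count at one [v] is at most the count in the box with [k i] more cells at any other point,
    hence at most the mean of the latter. *)
Lemma lattice_sum_box_le_mean g l n k h : g \in unitmx -> (forall i, 0 <= l i) ->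
  (forall p, mean (lattice_sum g (box p l)) h) -> covers g (fun i => (k i)%:R * l i) ->
  forall p v, lattice_sum g (box p (fun i => (n i)%:R * l i)) v <= \prod_i (n i + k i)%:R * h.
Proof.
move=> gU l0 mh ge p v; have [um _] := mean_box_scale (fun i => n i + k i)%N gU l0 mh p.
apply: umean_ge um _ => v'; apply: le_trans (lattice_sum_box_le _ _ _ _ gU ge) _.
by apply/eq_ler; congr (lattice_sum _ (box _ _) _); apply/funext => i; rewrite natrD mulrDl.
Qed.

(** A box of [k i + 1] cells in each direction meets every grid, so its mean is at least 1, and this
    mean is a multiple of [h]. *)
Lemma mean_box_gt0 g l h k : g \in unitmx -> (forall i, 0 < l i) ->
  (forall p, mean (lattice_sum g (box p l)) h) -> covers g (fun i => (k i)%:R * l i) -> 0 < h.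
Proof.
move=> gU l0 mh ge; have [um _] := mean_box_scale (fun i => (k i).+1) gU (fun i => ltW (l0 i)) mh 0.
have : 1 <= \prod_i (k i).+1%:R * h.
  apply: umean_ge um _ => v; have [z zv] := ge v.
  apply: le_trans (lattice_sum_ge v z gU (@bounded_box _ _ _ _) (@box_ge0 _ _ _ _)).
  rewrite box1// => i; rewrite [(0 : 'cV_d) i 0]mxE add0r.
  have /andP[-> zvi] := zv i.
  by apply: le_lt_trans zvi _; rewrite ltr_pM2r// ltr_nat.
by move=> /(lt_le_trans ltr01); rewrite pmulr_rgt0// prodr_gt0// => i _; rewrite ltr0n.
Qed.

End box_means.

(** * Lattices all of whose stretchings have bounded shape *)

Section correlations.
Context {R : realType} {d : nat}.
Implicit Types (g : 'M[R]_d) (u v p t : 'cV[R]_d) (l e A B S L : 'I_d -> R).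

Definition cbox l := box (\col_i (- (l i / 2))) l.

Lemma cbox_neq0 l u : cbox l u != 0 -> forall i, `|u i 0| <= l i / 2.
Proof.
move=> /box_neq0 b i; have := b i; rewrite mxE ler_norml => /andP[? ?].
by apply/andP; split; lra.
Qed.

Lemma mul_cbox A B (w : 'cV[R]_d) u :
  let hi A B (i : 'I_d) := Num.min (A i / 2) (B i / 2 - w i 0) in
  let lo A B (i : 'I_d) := Num.max (- (A i / 2)) (- (B i / 2) - w i 0) in
  cbox A u * cbox B (u + w) = box (\col_i lo A B i) (fun i => hi A B i - lo A B i) u.
Proof.
move=> hi lo; rewrite /cbox /box -big_split/=; apply: eq_bigr => i _.
rewrite !mxE -natrM mulnb /hi /lo (addrC (Num.max _ _)) subrK ge_max lt_min.
congr (_%:R); congr nat_of_bool.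
by apply/idP/idP => [/andP[/andP[? ?] /andP[? ?]]|/andP[/andP[? ?] /andP[? ?]]];
  do !(apply/andP; split); lra.
Qed.

(* The two products have equal means because [cbox A] and a translate of [cbox B]
   meet in a translate of the box in which [cbox S] and that translate of [cbox L] meet. *)
Lemma mean_mul_cbox g A B S L : g \in unitmx ->
  (forall i, (S i = A i /\ L i = B i) \/ (S i = B i /\ L i = A i)) ->
  exists c, mean (fun v => lattice_sum g (cbox A) v * lattice_sum g (cbox B) v) c /\
            mean (fun v => lattice_sum g (cbox S) v * lattice_sum g (cbox L) v) c.
Proof.
move=> gU SL; pose K l := \sum_i (`|(\col_i (- (l i / 2)) : 'cV[R]_d) i 0| + `|l i|).
have K0 l : 0 <= K l by apply: sumr_ge0 => i _; rewrite addr_ge0.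
have bK l : bounded_support (cbox l) (K l) by exact: bounded_box.
have [W uW WP] := lat_ball_seq 0 (K A + K B + (K S + K L)) gU.
pose h l := projT1 (cid (lattice_sum_box_mean l gU)).
have hP l p : mean (lattice_sum g (box p l)) (h l) by rewrite /h; case: cid.
pose len A B (w : 'cV[int]_d) (i : 'I_d) :=
  Num.min (A i / 2) (B i / 2 - lat g w i 0) - Num.max (- (A i / 2)) (- (B i / 2) - lat g w i 0).
have main A' B' : (forall w, (forall i, `|lat g w i 0| <= K A' + K B') -> w \in W) ->
    mean (fun v => lattice_sum g (cbox A') v * lattice_sum g (cbox B') v)
      (\sum_(w <- W) h (len A' B' w)).
  move=> WAB.
  apply: mean_ext (fun v => esym (lattice_sum_mul v gU (@bK A') (@bK B') uW WAB)) _.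
  apply: mean_sum => w; apply: mean_ext (hP _ _) => v.
  by congr (lattice_sum _ _ _); apply/funext => u; exact/esym/mul_cbox.
exists (\sum_(w <- W) h (len A B w)); split.
  apply: main => w wK; apply: WP => i; rewrite add0r; apply: le_trans (wK i) _.
  by rewrite lerDl addr_ge0.
have -> : \sum_(w <- W) h (len A B w) = \sum_(w <- W) h (len S L w).
  apply: eq_bigr => w _; congr h; apply/funext => i; rewrite /len.
  have [[-> ->]//|[-> ->]] := SL i.
  (* The overlap of two centered intervals, one of them displaced by [w], is symmetric in their two
     lengths, so each coordinate may be exchanged separately. *)
  rewrite /Num.min /Num.max; do 4 case: ifPn; rewrite -?leNgt; lra.
apply: main => w wK; apply: WP => i; rewrite add0r; apply: le_trans (wK i) _.
by rewrite lerDr addr_ge0.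
Qed.

(** After the exchange, the count in [L] is bounded at every point by that of its [q] cells per axis
    enlarged by [k] cells, and only the count in [S] is averaged. For [k] small against [q] this is
    nearly the product of the means. *)
Lemma umean_mul_cbox g A B S L c h hS q k : g \in unitmx ->
  (forall i, (S i = A i /\ L i = B i) \/ (S i = B i /\ L i = A i)) ->
  (forall i, 0 <= c i) -> (forall i, L i = q%:R * c i) ->
  covers g (fun i => k%:R * c i) -> (forall p, mean (lattice_sum g (box p c)) h) ->
  mean (lattice_sum g (cbox S)) hS ->
  umean (fun v => lattice_sum g (cbox A) v * lattice_sum g (cbox B) v) ((q + k)%:R ^+ d * h * hS).
Proof.
move=> gU SL c0 Lc gc mh mS; have [m [mAB mSL]] := mean_mul_cbox gU SL.
have [uAB _] := mAB; apply: umean_le uAB => //.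
have cntL v : lattice_sum g (cbox L) v <= (q + k)%:R ^+ d * h.
  have := lattice_sum_box_le_mean (fun=> q) gU c0 mh gc (\col_i (- (L i / 2))) v.
  by rewrite prodr_const card_ord /cbox (_ : L = fun i => q%:R * c i)//; exact/funext.
have h0 : 0 <= (q + k)%:R ^+ d * h.
  by apply: le_trans (cntL 0); apply: lattice_sum_ge0 gU (@bounded_box _ _ _ _) (@box_ge0 _ _ _ _).
apply: umean_mean_le mSL (umeanZ h0 (proj1 mS)) => v.
rewrite mulrC; apply: ler_wpM2r => //.
exact: lattice_sum_ge0 gU (@bounded_box _ _ _ _) (@box_ge0 _ _ _ _).
Qed.

End correlations.

Definition bad_shifts {R : realType} {d : nat} (g : 'M[R]_d) (th : 'I_d -> R) : set 'cV[R]_d :=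
  [set v | forall z, 2 ^- d * `|\det g| < \prod_i (`|(v + lat g z) i 0| + th i)].

Lemma exp1D_le (R : realDomainType) (x : R) m :
  0 <= x <= 1 -> (1 + x) ^+ m <= 1 + 3 ^+ m * x.
Proof.
move=> /andP[x0 x1]; elim: m => [|m ih]; first by rewrite !expr0 mul1r lerDl.
rewrite exprS; apply: le_trans (ler_wpM2l _ ih) _; first by rewrite addr_ge0.
rewrite exprS; have m1 : 1 <= 3 ^+ m :> R by rewrite exprn_ege1// ler1n.
have : 3 ^+ m * x * x <= 3 ^+ m * x * 1 by rewrite ler_wpM2l// mulr_ge0// exprn_ge0.
have : 1 * x <= 3 ^+ m * x by rewrite ler_wpM2r.
nra.
Qed.

Section recurrent.
Context {R : realType} {d : nat}.
Variables (i0 i1 : 'I_d) (i01 : i0 != i1).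

Let i10 : (i1 == i0) = false.
Proof. by rewrite eq_sym; exact/negbTE. Qed.

Lemma prod_two (a b : R) :
  \prod_i (if i == i0 then a else if i == i1 then b else 1) = a * b.
Proof.
rewrite (bigD1 i0)//= eqxx (bigD1 i1)/= i10// eqxx.
by rewrite big1 ?mulr1// => i /andP[/negbTE -> /negbTE ->].
Qed.

Variables (g : 'M[R]_d) (gU : g \in unitmx) (delta : R) (delta0 : 0 < delta).
(* The [j]-th box has sides [delta * (b ^ j, b ^ - j, 1, .., 1)].  With [b = q ^ d],
   the coordinatewise maximum of the [j]-th and [m]-th boxes is turned by the
   determinant one dilation [dil j m] into a cube of side [delta * q ^ (m - j)]. *)
Variables (b q k N : nat) (q0 : (0 < q)%N) (N0 : (0 < N)%N) (bE : b = (q ^ d)%N).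

Let b0 : 0 < b%:R :> R.
Proof. by rewrite ltr0n bE expn_gt0 q0. Qed.

Let side (j : nat) (i : 'I_d) : R :=
  delta * (if i == i0 then b%:R ^+ j else if i == i1 then b%:R ^- j else 1).

Let dil (j m : nat) (i : 'I_d) : R :=
  q%:R ^+ (m - j) * (if i == i0 then b%:R ^- m else if i == i1 then b%:R ^+ j else 1).

Hypothesis gcov : forall j m, (j <= m)%N -> (m < N)%N ->
  covers g (fun i => k%:R * (delta / dil j m i)).

Let side_gt0 j i : 0 < side j i.
Proof. by rewrite /side; do 2 ?case: ifP => _; rewrite mulr_gt0 ?invr_gt0 ?exprn_gt0. Qed.

Let qm0 m : q%:R ^+ m != 0 :> R.
Proof. by rewrite expf_neq0// pnatr_eq0 -lt0n. Qed.

Let bm0 m : b%:R ^+ m != 0 :> R.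
Proof. by rewrite expf_neq0// gt_eqF. Qed.

Let dil_gt0 j m i : 0 < dil j m i.
Proof.
rewrite /dil mulr_gt0 ?exprn_gt0 ?ltr0n//.
by do 2 ?case: ifP => _; rewrite ?invr_gt0 ?exprn_gt0.
Qed.

(** For [j <= m], [short] and [long] are the coordinatewise minimum and maximum of the sides of the
    [j]-th and [m]-th boxes. *)
Let short j m i : R :=
  delta * (if i == i0 then b%:R ^+ j else if i == i1 then b%:R ^- m else 1).
Let long j m i : R :=
  delta * (if i == i0 then b%:R ^+ m else if i == i1 then b%:R ^- j else 1).

(** Since [b] is an integer, both boxes and [long] are tiled by copies of [short]: [b ^ (m - j)]
    copies for each box and the square of this for [long]. Hence mean([long]) times mean([short]) is
    the square of the common mean; tiling replaces any computation of volumes. *)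
Let side_means : exists2 c, 0 < c & exists hs hc : nat -> nat -> R,
  forall j m, (j <= m)%N -> (m < N)%N ->
  [/\ forall p, mean (lattice_sum g (box p (side j))) c,
      forall p, mean (lattice_sum g (box p (side m))) c,
      mean (lattice_sum g (cbox (short j m))) (hs j m),
      forall p, mean (lattice_sum g (box p (fun i => delta / dil j m i))) (hc j m) &
      (q ^ (m - j))%:R ^+ d * hc j m * hs j m = c ^+ 2].
Proof.
pose h l := projT1 (cid (lattice_sum_box_mean l gU)).
have hP l p : mean (lattice_sum g (box p l)) (h l) by rewrite /h; case: cid.
have scale l l' (n : 'I_d -> nat) : (forall i, 0 < l i) -> (forall i, l' i = (n i)%:R * l i) ->
    h l' = (\prod_i (n i))%:R * h l.
  move=> l0 l'E; have -> : l' = fun i => (n i)%:R * l i by exact/funext.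
  have := mean_box_scale n gU (fun i => ltW (l0 i)) (hP l) 0.
  by rewrite natr_prod; exact: mean_uniq.
have short_gt0 j m i : 0 < short j m i.
  by rewrite /short; do 2 ?case: ifP => _; rewrite mulr_gt0 ?invr_gt0 ?exprn_gt0.
have bN j m : (j <= m)%N -> b%:R ^+ m = (b ^ (m - j))%:R * b%:R ^+ j :> R.
  by move=> jm; rewrite natrX -exprD subnK.
pose n (a a' : bool) j m (i : 'I_d) := if i == i0 then if a then (b ^ (m - j))%N else 1%N
  else if i == i1 then if a' then (b ^ (m - j))%N else 1%N else 1%N.
have prodn a a' j m : (\prod_i n a a' j m i)%N =
    ((if a then b ^ (m - j) else 1) * (if a' then b ^ (m - j) else 1))%N.
  rewrite /n (bigD1 i0)//= eqxx (bigD1 i1)/= i10// eqxx.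
  by rewrite big1 ?muln1// => i /andP[/negbTE -> /negbTE ->].
have e1 j m : (j <= m)%N -> h (side j) = (b ^ (m - j))%:R * h (short j m).
  move=> jm; rewrite (scale _ _ (n false true j m) (short_gt0 j m)).
    by rewrite prodn mul1n.
  move=> i; rewrite /side /short /n; case: ifP => _; first by rewrite mul1r.
  case: ifP => _; last by rewrite mul1r.
  by rewrite (bN j m)// mulrCA invfM; congr (_ * _); rewrite mulrA mulfV ?mul1r// natrX.
have e2 j m : (j <= m)%N -> h (side m) = (b ^ (m - j))%:R * h (short j m).
  move=> jm; rewrite (scale _ _ (n true false j m) (short_gt0 j m)).
    by rewrite prodn muln1.
  move=> i; rewrite /side /short /n; case: ifP => _.
    by rewrite (bN j m)// mulrCA.
  by case: ifP => _; rewrite mul1r.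
have e3 j m : (j <= m)%N -> h (long j m) = (b ^ (m - j))%:R ^+ 2 * h (short j m).
  move=> jm; rewrite (scale _ _ (n true true j m) (short_gt0 j m)).
    by rewrite prodn natrM -expr2.
  move=> i; rewrite /long /short /n; case: ifP => _.
    by rewrite (bN j m)// mulrCA.
  case: ifP => _; last by rewrite mul1r.
  by rewrite (bN j m)// mulrCA invfM; congr (_ * _); rewrite mulrA mulfV ?mul1r// natrX.
have cell_gt0 j m i : 0 < delta / dil j m i by rewrite divr_gt0.
have longE j m i : (j <= m)%N -> long j m i = (q ^ (m - j))%:R * (delta / dil j m i).
  move=> jm; rewrite /long /dil natrX invfM mulrCA; congr (_ * _).
  rewrite mulrA mulfV// mul1r.
  by do 2 (case: ifP => _; rewrite ?invrK// ?invr1//).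
have e4 j m : (j <= m)%N -> h (long j m) =
    (q ^ (m - j))%:R ^+ d * h (fun i => delta / dil j m i).
  move=> jm; rewrite (scale _ _ (fun=> q ^ (m - j))%N (cell_gt0 j m)).
    by rewrite prod_nat_const card_ord natrX.
  by move=> i; exact: longE.
have sideE m : h (side m) = h (side 0%N) by rewrite (e2 0%N m)// -e1.
exists (h (side 0%N)).
  have := gcov (leqnn 0) N0.
  have -> : (fun i => k%:R * (delta / dil 0 0 i)) = (fun i => k%:R * side 0 i).
    apply/funext => i; rewrite /dil /side subnn !expr0 mul1r invr1.
    by do 2 (case: ifP => _; rewrite ?invr1//).
  exact: mean_box_gt0 gU (side_gt0 0) (hP (side 0%N)).
exists (fun j m => h (short j m)), (fun j m => h (fun i => delta / dil j m i)) => j m jm mN.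
split=> //.
- by move=> p; rewrite -(sideE j).
- by move=> p; rewrite -(sideE m).
- exact: hP.
by rewrite -e4// e3// -(sideE j) (e1 j m)// expr2 [RHS]expr2; ring.
Qed.

Lemma umean_recurrent_bad th : (k <= q)%N ->
  (forall i, 0 <= th i <= delta / 2 / b%:R ^+ N) ->
  delta ^+ d <= 2 ^- d * `|\det g| ->
  umean (fun v => (v \in bad_shifts g th)%:R)
    (3 ^+ d * (k%:R / q%:R) + (1 + k%:R) ^+ d / N%:R : R).
Proof.
move=> kq thb det_delta; have [c c0 [hs [hc P]]] := side_means.
have NR : 0 < N%:R :> R by rewrite ltr0n.
pose eta : R := 3 ^+ d * (k%:R / q%:R).
have eta0 : 0 <= eta by rewrite /eta mulr_ge0 ?exprn_ge0// divr_ge0.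
have k1 : 0 <= (1 + k%:R) ^+ d :> R by rewrite exprn_ge0// addr_ge0.
(* Off the diagonal [q ^ (m - j)] is at least [q], so [(1 + k / q ^ (m - j)) ^ d] exceeds 1 by at
   most [eta]. On the diagonal only [(1 + k) ^ d] is available, but it occurs [N] times among
   [N ^ 2] pairs. *)
pose y (j m : 'I_N) : R := eta + (j == m)%:R * (1 + k%:R) ^+ d.
have pair (j m : 'I_N) : (j <= m)%N -> umean (fun v => lattice_sum g (cbox (side j)) v *
    lattice_sum g (cbox (side m)) v) (c ^+ 2 * (1 + y j m)).
  move=> jm; have [_ _ Ps Pc E] := P j m jm (ltn_ord m).
  have qm : 0 < (q ^ (m - j))%:R :> R by rewrite ltr0n expn_gt0 q0.
  have SL i : (short j m i = side j i /\ long j m i = side m i) \/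
              (short j m i = side m i /\ long j m i = side j i).
    rewrite /short /long /side; case: ifP => _; first by left.
    by case: ifP => _; [right|left].
  have Lc i : long j m i = (q ^ (m - j))%:R * (delta / dil j m i).
    rewrite /long /dil natrX invfM mulrCA; congr (_ * _).
    rewrite mulrA mulfV// mul1r.
    by do 2 (case: ifP => _; rewrite ?invrK// ?invr1//).
  have c0' i : 0 <= delta / dil j m i by rewrite divr_ge0 ?ltW.
  apply: umean_le (umean_mul_cbox gU SL c0' Lc (gcov jm (ltn_ord m)) Pc Ps) => //.
  have -> : (q ^ (m - j) + k)%:R ^+ d * hc j m * hs j m =
      c ^+ 2 * (1 + k%:R / (q ^ (m - j))%:R) ^+ d.
    rewrite -E natrD -[X in _ = _ * (X + _) ^+ _](mulfV (lt0r_neq0 qm)) -mulrDl expr_div_n.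
    have := expf_neq0 d (lt0r_neq0 qm); set Q := _ ^+ d => Q0.
    by rewrite mulrC !mulrA; field.
  rewrite ler_pM2l ?exprn_gt0// /y; have [->|njm] := eqVneq j m.
    by rewrite subnn expn0 divr1 mul1r; lra.
  rewrite mul0r addr0; apply: le_trans (exp1D_le _ _) _.
    rewrite divr_ge0//= ler_pdivrMr// mul1r ler_nat (leq_trans kq)//.
    rewrite -{1}[q]expn1 leq_pexp2l// subn_gt0 ltn_neqAle jm andbT.
    by apply: contraNneq njm => /val_inj ->.
  rewrite lerD2l /eta ler_pM2l ?exprn_gt0//.
  apply: ler_wpM2l => //; rewrite lef_pV2 ?posrE ?ltr0n ?expn_gt0 ?q0//.
  rewrite ler_nat -{1}[q]expn1 leq_pexp2l// subn_gt0 ltn_neqAle jm andbT.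
  by apply: contraNneq njm => /val_inj ->.
have -> : 3 ^+ d * (k%:R / q%:R) + (1 + k%:R) ^+ d / N%:R =
    (\sum_j \sum_m y j m) / N%:R ^+ 2 :> R.
  have -> : \sum_j \sum_m y j m = N%:R ^+ 2 * eta + N%:R * (1 + k%:R) ^+ d.
    transitivity (\sum_(j < N) (N%:R * eta + (1 + k%:R) ^+ d)).
      apply: eq_bigr => j _; rewrite big_split/= sumr_const card_ord.
      congr (_ + _); first by rewrite mulr_natl.
      rewrite (bigD1 j)//= eqxx mul1r big1 ?addr0// => m mj.
      by rewrite eq_sym (negbTE mj) mul0r.
    by rewrite sumr_const card_ord -[LHS]mulr_natl mulrDr mulrA -expr2.
  by rewrite /eta; field; rewrite ?gt_eqF// ltr0n q0.
apply: (@umean_second_moment _ _ N (fun j => lattice_sum g (cbox (side j))) _ c) => //.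
- by move=> j; have [Pj _ _ _ _] := P j j (leqnn _) (ltn_ord j); exact: Pj.
- move=> j m; have [jm|/ltnW mj] := leqP j m; first exact: pair.
  apply: umean_le (pair m j mj) => [v|]; first by rewrite mulrC.
  by rewrite /y eq_sym.
(* A bad grid misses every box: a point of the centered box has coordinates at most half a side, the
   margin adds at most another half, and the product of the sides is [delta ^ d]. *)
move=> v bv j; rewrite /lattice_sum fsbig1// => z _; apply/eqP/negPn/negP => /cbox_neq0 vz.
have := bv z; rewrite ltNge => /negP; apply; apply: le_trans det_delta.
have -> : delta ^+ d = \prod_i side j i.
  by rewrite /side big_split/= prod_two mulfV// mulr1 prodr_const card_ord.
apply: ler_prod => i _; have /andP[th0 thi] := thb i.
rewrite addr_ge0//= [leRHS]splitr; apply: lerD; first exact: vz.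
apply: le_trans thi _; rewrite mulrAC ler_pM2r ?invr_gt0//.
have b1 : 1 <= b%:R :> R by rewrite ler1n bE expn_gt0 q0.
have bN1 : b%:R ^- N <= 1 :> R by rewrite invf_le1 ?exprn_gt0// exprn_ege1.
rewrite /side ler_pM2l//; case: ifP => _.
  by apply: le_trans bN1 _; rewrite exprn_ege1.
case: ifP => _ //.
by rewrite lef_pV2 ?posrE ?exprn_gt0// ler_weXn2l// ltnW.
Qed.

End recurrent.

Lemma exists_nat_divr_le (R : archiRealFieldType) (a e : R) : 0 < e ->
  exists2 n : nat, (0 < n)%N & forall m : nat, (n <= m)%N -> a / m%:R <= e.
Proof.
move=> e0; exists (Num.truncn (a / e)).+1 => // m nm.
have m0 : 0 < m%:R :> R by rewrite ltr0n (leq_trans _ nm).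
rewrite ler_pdivrMr// mulrC -ler_pdivrMr//.
by apply/ltW/(lt_le_trans (truncnS_gt _)); rewrite ler_nat.
Qed.

Lemma umean_bad_recurrent (R : realType) (d k : nat) (e : R) : (1 < d)%N -> 0 < e ->
  exists2 B : R, 1 <= B & forall (g : 'M[R]_d) (delta : R) (th : 'I_d -> R),
    g \in unitmx -> 0 < delta ->
    (forall a : 'I_d -> R, (forall i, B^-1 <= a i <= B) -> \prod_i a i = 1 ->
      covers g (fun i => k%:R * (delta / a i))) ->
    (forall i, 0 <= th i <= delta / 2 / B) ->
    delta ^+ d <= 2 ^- d * `|\det g| ->
    umean (fun v => (v \in bad_shifts g th)%:R) e.
Proof.
move=> d1 e0; have e20 : 0 < e / 2 by rewrite divr_gt0.
have [q' q'0 qP] := exists_nat_divr_le (3 ^+ d * k%:R) e20.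
have [N N0 NP] := exists_nat_divr_le ((1 + k%:R) ^+ d) e20.
pose q := maxn q' k; have q0 : (0 < q)%N by rewrite leq_max q'0.
pose b := (q ^ d)%N.
have q1 : 1 <= q%:R :> R by rewrite ler1n.
have b1 : 1 <= b%:R :> R by rewrite ler1n expn_gt0 q0.
have b0 : 0 < b%:R :> R by exact: lt_le_trans b1.
have pow1 (x : R) m : 1 <= x -> 1 <= x ^+ m by move=> ?; rewrite exprn_ege1.
(* Bounds the entries of all dilations in play and their inverses; it depends on [d], [k] and [e]
   only. *)
pose B : R := q%:R ^+ N * b%:R ^+ N.
have qB : q%:R ^+ N <= B by rewrite ler_peMr ?exprn_ge0// pow1.
have bB : b%:R ^+ N <= B by rewrite ler_peMl ?exprn_ge0// pow1.
have B1 : 1 <= B by apply: le_trans bB; exact: pow1.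
exists B => // g delta th gU delta0 gcov thb det_delta.
pose i0 := Ordinal (ltnW d1); pose i1 := Ordinal d1.
have i01 : i0 != i1 by [].
have thb' i : 0 <= th i <= delta / 2 / b%:R ^+ N.
  have /andP[-> h]/= := thb i; apply: le_trans h _.
  by rewrite ler_pM2l ?divr_gt0// lef_pV2 ?posrE ?exprn_gt0// (lt_le_trans _ B1).
apply: umean_le
  (umean_recurrent_bad i01 gU delta0 q0 N0 erefl _ (leq_maxr _ _) thb' det_delta) => //.
  rewrite [leRHS]splitr mulrA; apply: lerD; last exact: NP.
  by apply: qP; exact: leq_maxl.
move=> j m jm mN; apply: gcov => [i|]; last first.
  rewrite big_split/= (prod_two i01) prodr_const card_ord -exprM.
  rewrite -/b (_ : b%:R = q%:R ^+ d :> R) ?natrX// -!exprM.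
  have -> : q%:R ^+ (d * m) = q%:R ^+ ((m - j) * d) * q%:R ^+ (d * j) :> R.
    by rewrite -exprD (mulnC _ d) -mulnDr subnK.
  by field; rewrite !expf_neq0// pnatr_eq0 -lt0n.
have qle : q%:R ^+ (m - j) <= q%:R ^+ N :> R.
  by rewrite ler_weXn2l// (leq_trans (leq_subr _ _))// ltnW.
have q1' : 1 <= q%:R ^+ (m - j) :> R by exact: pow1.
have q0' : 0 < q%:R ^+ (m - j) :> R by exact: lt_le_trans q1'.
have Bi : B^-1 <= 1 by rewrite invf_le1// (lt_le_trans _ B1).
case: ifP => _; [|case: ifP => _]; apply/andP; split.
- apply: (@le_trans _ _ (b%:R ^- m)); last by rewrite ler_peMl ?invr_ge0 ?exprn_ge0.
  rewrite lef_pV2 ?posrE ?exprn_gt0// ?(lt_le_trans _ B1)//.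
  by apply: le_trans bB; rewrite ler_weXn2l// ltnW.
- apply: le_trans qB; apply: le_trans qle.
  rewrite ler_piMr ?(ltW q0')//.
  by rewrite invf_le1 ?exprn_gt0// pow1.
- by apply: le_trans Bi _; rewrite mulr_ege1// pow1.
- apply: ler_pM; rewrite ?(ltW q0') ?exprn_ge0//.
  by rewrite ler_weXn2l// (leq_trans jm)// ltnW.
- by apply: le_trans Bi _; rewrite mulr1.
- by rewrite mulr1; apply: le_trans qle qB.
Qed.

(** * Bases adapted to a sublattice *)

Lemma perm_extends_inj r s (f : 'I_r -> 'I_(r + s)) : injective f ->
  exists sg : 'S_(r + s), forall i, sg (lshift s i) = f i.
Proof.
move=> fI; pose J := ~: [set f i | i in 'I_r].
have cJ : #|J| = s.
  by have := cardsC [set f i | i in 'I_r]; rewrite card_imset// !card_ord -/J => /addnI.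
pose h (i : 'I_(r + s)) := match fintype.split i with
  | inl a => f a | inr b => enum_val (cast_ord (esym cJ) b) end.
have hJ b : enum_val (cast_ord (esym cJ) b) \in J by exact: enum_valP.
have fJ a : f a \notin J by rewrite inE negbK imset_f.
have hI : injective h.
  move=> i j; rewrite /h -{2}(splitK i) -{2}(splitK j).
  case: (fintype.split i) => a; case: (fintype.split j) => b //=.
  - by move=> /fI ->.
  - by move=> E; have := fJ a; rewrite E hJ.
  - by move=> E; have := fJ b; rewrite -E hJ.
  - by move=> /enum_val_inj/cast_ord_inj ->.
exists (perm hI) => i; rewrite permE /h.
case: fintype.splitP => [j /= /val_inj ->//|j /= ij].
by have := ltn_ord i; rewrite ij ltnNge leq_addr.
Qed.

Lemma cramer_row (R : comUnitRingType) r s (P : 'M[R]_r) (X : 'M[R]_(s, r)) i j :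
  P \in unitmx ->
  \det (\matrix_(a, b) if a == i then X j b else P a b) = (X *m invmx P) j i * \det P.
Proof.
move=> PU; rewrite (expand_det_row _ i) /invmx PU -scalemxAr mxE mulrAC mulVr -?unitmxE//.
rewrite mul1r mxE; apply: eq_bigr => b _; rewrite !mxE eqxx; congr (_ * _).
rewrite /cofactor; congr (_ * \det _); apply/matrixP => a c; rewrite !mxE.
by rewrite eq_sym (negbTE (neq_lift _ _)).
Qed.

Section lattices.
Context {R : realType}.

Local Notation "V ^ir" := (map_mx intr V : 'M[R]_(_, _)) (at level 2, format "V ^ir").

(** In the basis given by the columns of [L], the first [r] vectors span the primitive closure of
    the sublattice generated by the columns of [V], and [V'] expresses the latter in the former. *)
Lemma int_smith_col r s (V : 'M[int]_(r + s, r)) : \rank V^ir = r ->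
  exists2 L : 'M[int]_(r + s), L \in unitmx &
  exists2 V' : 'M[int]_r, \det V' != 0 & V = L *m col_mx V' 0.
Proof.
move=> rV; have [L LU [X XU [e _ VE]]] := int_Smith_normal_form V.
pose D : 'M[int]_r := \matrix_(i, j) (e`_i *+ (i == j)).
have DX : \matrix_(i < r + s, j < r) (e`_i *+ (i == j :> nat)) *m X = col_mx (D *m X) 0.
  rewrite -[Z in _ = col_mx _ Z](mul0mx _ X) -mul_col_mx; congr (_ *m _).
  apply/matrixP => i j; rewrite [RHS]mxE; case: fintype.splitP => k ik /=; rewrite !mxE ik//.
  by rewrite gtn_eqF// (leq_trans (ltn_ord j))// leq_addr.
exists L => //; exists (D *m X).
  apply: contraT => /negPn/eqP D0.
  have : (\rank ((D *m X)^ir) < r)%N.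
    rewrite ltn_neqAle rank_leq_row andbT; apply/negP => rD.
    have : (D *m X)^ir \in unitmx by rewrite -row_free_unit.
    by rewrite unitmxE det_map_mx D0 rmorph0 unitr0.
  suff : (r <= \rank (D *m X)^ir)%N by rewrite leqNgt => /negbTE ->.
  rewrite -{1}rV VE -mulmxA.
  rewrite DX map_mxM map_col_mx map_mx0; apply: leq_trans (mxrankM_maxr _ _) _.
  by rewrite -addsmxE addsmx0.
by rewrite VE -mulmxA DX.
Qed.

Lemma det_block r s (P : 'M[R]_r) (Q : 'M[R]_(r, s)) (K : 'M[R]_(s, r)) (S : 'M[R]_s) :
  \det (block_mx P Q (K *m P) (K *m Q + S)) = \det P * \det S.
Proof.
have -> : block_mx P Q (K *m P) (K *m Q + S) = block_mx 1%:M 0 K 1%:M *m block_mx P Q 0 S.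
  by rewrite mulmx_block !mul1mx !mul0mx !addr0.
by rewrite det_mulmx det_lblock det_ublock !det1 !mul1r.
Qed.

(* Choosing the rows of [P] so that [|det P|] is maximal makes all entries of [K]
   at most 1 in absolute value, by Cramer's rule. *)
Lemma unit_block r s (g : 'M[R]_(r + s)) : g \in unitmx ->
  exists sg : 'S_(r + s), exists P Q K S,
  [/\ row_perm sg g = block_mx P Q (K *m P) (K *m Q + S),
      P \in unitmx, S \in unitmx & forall i j, `|K i j| <= 1].
Proof.
move=> gU; pose m sg : R := `|\det (ulsubmx (row_perm sg g))|.
have [sg0 m0] : exists sg, m sg != 0.
  have lf : row_full (lsubmx g).
    rewrite /row_full eqn_leq rank_leq_col/=.
    have : (r + s <= \rank (lsubmx g) + \rank (rsubmx g))%N.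
      rewrite -{1}(mxrank_unit gU) -{1}(hsubmxK g) -mxrank_tr tr_row_mx.
      by rewrite -addsmxE (leq_trans (mxrank_adds_leqif _ _))// !mxrank_tr.
    by move=> h; have := rank_leq_col (rsubmx g); lia.
  have [sg sgE] := perm_extends_inj (s := s) (@fullrankfun_inj _ _ _ _ lf).
  exists sg; rewrite /m normr_eq0 -unitfE -unitmxE.
  have -> : ulsubmx (row_perm sg g) = rowsub (fullrankfun lf) (lsubmx g).
    by apply/matrixP => i j; rewrite !mxE sgE.
  exact: fullrowsub_unit.
case: (@Order.TotalTheory.arg_maxP _ _ _ sg0 predT m) => // sg _ msg.
have {sg0 m0} msg0 : m sg != 0.
  by rewrite gt_eqF// (lt_le_trans _ (msg sg0 _))// lt0r m0 normr_ge0.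
pose B := row_perm sg g; pose P := ulsubmx B; pose K := dlsubmx B *m invmx P.
have PU : P \in unitmx by rewrite unitmxE unitfE -normr_eq0.
have BE : B = block_mx P (ursubmx B) (K *m P) (K *m ursubmx B + (drsubmx B - K *m ursubmx B)).
  by rewrite /K mulmxKV// addrC subrK submxK.
have detB : \det B = \det P * \det (drsubmx B - K *m ursubmx B).
  by rewrite {1}BE det_block.
exists sg, P, (ursubmx B), K, (drsubmx B - K *m ursubmx B); split => //.
  have : B \in unitmx by rewrite /B row_permE unitmx_mul unitmx_perm.
  by rewrite unitmxE detB unitfE mulf_eq0 negb_or unitmxE unitfE => /andP[].
move=> j i; have mP : 0 < m sg by rewrite lt0r msg0 normr_ge0.
rewrite -(ler_pM2r mP) mul1r {1}/m -/B -/P -normrM /K -cramer_row//.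
apply: le_trans (msg (tperm (lshift s i) (rshift r j) * sg)%g isT).
rewrite /m; apply/eq_ler; congr (`|\det _|); apply/matrixP => a b; rewrite !mxE permM.
case: (eqVneq a i) => [->|ai]; first by rewrite tpermL.
rewrite tpermD ?eq_rlshift//; first by rewrite (inj_eq (@lshift_inj _ _)) eq_sym.
Qed.

End lattices.

(** * First minimum and block form of a lattice *)

Section separation.
Context {R : realType}.

Local Notation "V ^ir" := (map_mx intr V : 'M[R]_(_, _)) (at level 2, format "V ^ir").

Definition separated d (g : 'M[R]_d) (t : R) :=
  forall z : 'cV[int]_d, z != 0 -> exists i, t <= `|lat g z i 0|.

Lemma sep_le d (g : 'M[R]_d) t t' : t' <= t -> separated g t -> separated g t'.
Proof. by move=> tt' gt z /gt[i ti]; exists i; exact: le_trans ti. Qed.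

Lemma map_intr_inj m n : injective (fun V : 'M[int]_(m, n) => V^ir).
Proof.
move=> V W VW; apply/matrixP => i j; apply/eqP.
by have := congr1 (fun A : 'M[R]_(m, n) => A i j) VW; rewrite !mxE => /eqP; rewrite eqr_int.
Qed.

Lemma unit_sep d (g : 'M[R]_d) : g \in unitmx -> exists2 t, 0 < t & separated g t.
Proof.
move=> gU; pose M := 1 + \sum_i \sum_j `|invmx g i j|.
have M0 : 0 < M.
  by rewrite ltr_pwDl// sumr_ge0// => i _; rewrite sumr_ge0.
exists M^-1; first by rewrite invr_gt0.
move=> z z0; apply: contrapT => /forallNP zs.
case/negP: z0; apply/eqP/matrixP => i j; rewrite ord1 [RHS]mxE {j}; apply/eqP.
rewrite -normr_le0 -ltzD1 add0r -(ltr_int R) intr_norm.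
have -> : (z i 0)%:~R = (invmx g *m (lat g z)) i 0 by rewrite /lat mulKmx// mxE.
rewrite mxE; apply: le_lt_trans (ler_norm_sum _ _ _) _.
apply: (@le_lt_trans _ _ (\sum_j `|invmx g i j| * M^-1)).
  apply: ler_sum => j _; rewrite normrM ler_wpM2l//.
  by apply: ltW; rewrite ltNge; apply/negP/zs.
rewrite -mulr_suml ltr_pdivrMr// mul1r /M [X in _ < 1 + X](bigD1 i)//= addrCA ltrDl ltr_pwDl//.
by rewrite sumr_ge0// => k _; rewrite sumr_ge0.
Qed.

(** [t'] is the first minimum in the sup norm; the factor [c > 1] spares showing that the infimum is
    attained. *)
Lemma sep_near_min d (g : 'M[R]_d) t c : (0 < d)%N -> 0 < t -> 1 < c -> separated g t ->
  exists2 t', t <= t' & separated g t' /\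
  exists2 w, w != 0 & forall i, `|lat g w i 0| <= c * t'.
Proof.
move=> d0 t0 c1 gt.
pose A := [set N | exists2 w, w != 0 & forall i, `|lat g w i 0| <= N].
have At N : A N -> t <= N.
  by move=> [w w0 wN]; have [i ti] := gt w w0; exact: le_trans (wN i).
have A0 : has_inf A.
  split; last by exists t => N /At.
  exists (\sum_i `|lat g (const_mx 1) i 0|); exists (const_mx 1).
    apply/eqP => /matrixP/(_ (Ordinal d0) 0); rewrite !mxE.
    by move/eqP; rewrite oner_eq0.
  by move=> i; rewrite (bigD1 i)//= lerDl sumr_ge0.
have tA : t <= inf A by apply: lb_le_inf => //; case: A0.
have iA0 : 0 < inf A by exact: lt_le_trans tA.
exists (inf A) => //; split.
  move=> z z0; apply: contrapT => /forallNP zs.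
  pose N := \big[Num.max/0]_i `|lat g z i 0|.
  have NA : N < inf A.
    by apply: bigmax_lt => // i _; rewrite ltNge; apply/negP/zs.
  have : inf A <= N.
    apply: ge_inf; first by case: A0.
    by exists z => // i; exact: (le_bigmax _ (fun i => `|lat g z i 0|)).
  by rewrite leNgt NA.
have e0 : 0 < (c - 1) * inf A by rewrite mulr_gt0// subr_gt0.
have [N [w w0 wN] Nlt] := inf_adherent e0 A0.
exists w => // i; apply: le_trans (wN i) _; apply/ltW/(lt_le_trans Nlt).
by rewrite mulrBl mul1r addrC subrK.
Qed.

Lemma lat_mul d (g : 'M[R]_d) (L : 'M[int]_d) z : lat (g *m L^ir) z = lat g (L *m z).
Proof. by rewrite /lat map_mxM mulmxA. Qed.

Lemma lat_row_perm d (g : 'M[R]_d) (sg : 'S_d) z : lat (row_perm sg g) z = row_perm sg (lat g z).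
Proof. by rewrite /lat !row_permE mulmxA. Qed.

Lemma mulmx_unit_neq0 d (L : 'M[int]_d) (z : 'cV_d) : L \in unitmx -> z != 0 -> L *m z != 0.
Proof. by move=> LU; apply: contraNneq => Lz; rewrite -[z](mulKmx LU) Lz mulmx0. Qed.

Lemma sep_row_perm d (g : 'M[R]_d) (sg : 'S_d) t : separated g t -> separated (row_perm sg g) t.
Proof.
move=> gt z /gt[i ti]; exists ((sg^-1)%g i).
by rewrite lat_row_perm mxE permKV.
Qed.

Lemma sep_mul d (g : 'M[R]_d) (L : 'M[int]_d) t :
  L \in unitmx -> separated g t -> separated (g *m L^ir) t.
Proof. by move=> LU gt z z0; rewrite lat_mul; apply: gt; exact: mulmx_unit_neq0. Qed.

Section block.
Variables (r s : nat) (P : 'M[R]_r) (Q : 'M[R]_(r, s)) (K : 'M[R]_(s, r)) (S : 'M[R]_s).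
Local Notation B := (block_mx P Q (K *m P) (K *m Q + S)).

(** The map taking [(v1, v2)] to [v2 - K v1] kills the first [r] basis vectors and sends the others
    to the columns of [S]. So the sublattice is the graph of [K] over the lattice of [P], and the
    quotient is the lattice of [S]. *)
Lemma lat_block z1 z2 : lat B (col_mx z1 z2) =
  col_mx (lat P z1 + lat Q z2) (K *m (lat P z1 + lat Q z2) + lat S z2).
Proof.
rewrite /lat map_col_mx mul_block_col mulmxDr mulmxDl !mulmxA.
by rewrite -!addrA.
Qed.

Hypothesis K1 : forall i j, `|K i j| <= 1.

Lemma mulmx_le1 (u : 'cV[R]_r) a j : (forall i, `|u i 0| <= a) -> `|(K *m u) j 0| <= r%:R * a.
Proof.
move=> ua; rewrite mxE; apply: le_trans (ler_norm_sum _ _ _) _.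
have -> : r%:R * a = \sum_(i < r) a by rewrite sumr_const card_ord mulr_natl.
by apply: ler_sum => i _; rewrite normrM -[a]mul1r ler_pM.
Qed.

(** A sublattice vector is [(u, K u)], and the entries of [K u] exceed those of [u] by a factor [r]
    at most. *)
Lemma sep_block_ul t : (0 < r)%N -> 0 < t -> separated B t -> separated P (t / r%:R).
Proof.
move=> r0 t0 Bt z z0; apply: contrapT => /forallNP zs.
have zs' i : `|lat P z i 0| < t / r%:R by rewrite ltNge; apply/negP/zs.
have r1 : t / r%:R <= t by rewrite ler_pdivrMr ?ltr0n// ler_peMr ?ler1n ?(ltW t0).
have [|i] := Bt (col_mx z 0).
  by apply: contraNneq z0 => /eqP; rewrite col_mx_eq0 => /andP[].
rewrite lat_block !lat0 !addr0; apply/negP; rewrite -ltNge.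
case: (split_ordP i) => j ->; rewrite ?col_mxEu ?col_mxEd.
  exact: lt_le_trans (zs' j) r1.
pose a := \big[Num.max/0]_i `|lat P z i 0|.
apply: (@le_lt_trans _ _ (r%:R * a)).
  by apply: mulmx_le1 => k; exact: (le_bigmax _ (fun i => `|lat P z i 0|)).
rewrite mulrC -ltr_pdivlMr ?ltr0n//; apply: bigmax_lt => // .
by rewrite divr_gt0// ltr0n.
Qed.

(** A quotient vector lifts to a lattice vector whose first [r] coordinates are at most [a < t]. The
    large coordinate is then among the last [s], where [K] contributes at most [r * a]. *)
Lemma sep_block_dr t a : a < t ->
  (forall v : 'cV[R]_r, exists z, forall i, `|(v + lat P z) i 0| <= a) ->
  (forall z1 z2, z2 != 0 -> exists i, t <= `|lat B (col_mx z1 z2) i 0|) ->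
  separated S (t - r%:R * a).
Proof.
move=> at_ Pa Bt z z0; have [z1 z1P] := Pa (lat Q z).
have z1P' i : `|(lat P z1 + lat Q z) i 0| <= a by rewrite addrC.
have [i] := Bt z1 z z0; rewrite lat_block.
case: (split_ordP i) => j ->; rewrite ?col_mxEu ?col_mxEd.
  by move=> /le_trans/(_ (z1P' j)); rewrite leNgt at_.
rewrite mxE => tj; exists j; rewrite lerBlDl; apply: le_trans tj _.
apply: le_trans (ler_normD _ _) _; rewrite lerD2r; exact: mulmx_le1.
Qed.

End block.

Lemma det_row_perm d (g : 'M[R]_d) (sg : 'S_d) : `|\det (row_perm sg g)| = `|\det g|.
Proof. by rewrite row_permE det_mulmx det_perm normrM normr_sign mul1r. Qed.

Lemma det_mul_unit d (g : 'M[R]_d) (L : 'M[int]_d) : L \in unitmx ->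
  `|\det (g *m L^ir)| = `|\det g|.
Proof.
rewrite unitmxE => LU; rewrite det_mulmx det_map_mx normrM -intr_norm.
by have /orP[] : (\det L == 1) || (\det L == -1); [|move=> /eqP ->; rewrite mulr1..].
Qed.

Lemma nearest_int (x : R) : exists m : int, `|x - m%:~R| <= 2^-1.
Proof.
exists (Num.floor (x + 2^-1)); have := floor_le (x + 2^-1).
have := floorD1_gt (x + 2^-1); rewrite intrD => *; rewrite ler_norml; apply/andP; split; lra.
Qed.

End separation.

Section more_lattices.
Context {R : realType}.

Local Notation "V ^ir" := (map_mx intr V : 'M[R]_(_, _)) (at level 2, format "V ^ir").

(** The [k]-th successive minimum in the sup norm is at most [C]. *)
Definition has_short d (g : 'M[R]_d) k (C : R) :=
  exists2 V : 'M[int]_(d, k), \rank V^ir = k & forall i j, `|(g *m V^ir) i j| <= C.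

Lemma adapted_basis r s (g : 'M[R]_(r + s)) (V : 'M[int]_(r + s, r)) :
  g \in unitmx -> \rank V^ir = r ->
  exists (sg : 'S_(r + s)) (L : 'M[int]_(r + s)) (V' : 'M[int]_r)
    (P : 'M[R]_r) (Q : 'M[R]_(r, s)) (K : 'M[R]_(s, r)) (S : 'M[R]_s),
  [/\ L \in unitmx, \det V' != 0, V = L *m col_mx V' 0,
      row_perm sg (g *m L^ir) = block_mx P Q (K *m P) (K *m Q + S) &
      [/\ P \in unitmx, S \in unitmx & forall i j, `|K i j| <= 1]].
Proof.
move=> gU rV; have [L LU [V' V'0 VE]] := int_smith_col rV.
have gLU : g *m L^ir \in unitmx.
  rewrite unitmx_mul gU/= unitmxE det_map_mx rmorph_unit//.
have [sg [P [Q [K [S [E PU SU K1]]]]]] := unit_block gLU.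
by exists sg, L, V', P, Q, K, S.
Qed.

Lemma adapted_basis_short r s (g : 'M[R]_(r + s)) (V : 'M[int]_(r + s, r))
    (sg : 'S_(r + s)) (L : 'M[int]_(r + s)) (V' : 'M[int]_r)
    (P : 'M[R]_r) (Q : 'M[R]_(r, s)) (K : 'M[R]_(s, r)) (S : 'M[R]_s) C :
  (forall i j, `|(g *m V^ir) i j| <= C) -> V = L *m col_mx V' 0 ->
  row_perm sg (g *m L^ir) = block_mx P Q (K *m P) (K *m Q + S) ->
  forall i j, `|(P *m V'^ir) i j| <= C.
Proof.
move=> gV VE E i j.
have -> : (P *m V'^ir) i j = (g *m V^ir) (sg (lshift s i)) j; last exact: gV.
transitivity ((row_perm sg (g *m V^ir)) (lshift s i) j); last by rewrite mxE.
rewrite VE map_mxM mulmxA.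
have -> : row_perm sg (g *m L^ir *m (col_mx V' 0)^ir) = row_perm sg (g *m L^ir) *m (col_mx V' 0)^ir.
  by rewrite !row_permE mulmxA.
by rewrite E map_col_mx map_mx0 mul_block_col !mulmx0 !addr0 col_mxEu.
Qed.

(** Minkowski's first theorem with a crude constant, by splitting off a nearly shortest vector and
    passing to the quotient. *)
Lemma det_ge_sep d (g : 'M[R]_d) t : g \in unitmx -> 0 < t -> separated g t ->
  t ^+ d <= 3 ^+ (d * d) * `|\det g|.
Proof.
elim: d g t => [|d ih] g t gU t0 gt; first by rewrite det_mx00 normr1 mulr1.
(* Rounding along a vector of size [4/3 t'] leaves at most [2/3 t'], so the quotient is separated by
   [t' / 3]. This is the source of the powers of 3. *)
have c1 : 1 < 4 / 3 :> R by lra.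
have [t' tt' [gt' [w w0 wt]]] := sep_near_min (ltn0Sn d) t0 c1 gt.
have t'0 : 0 < t' by exact: lt_le_trans tt'.
apply: (@le_trans _ _ (t' ^+ d.+1)); first by rewrite lerXn2r// nnegrE ltW.
rewrite -[d.+1]/(1 + d)%N in g gU gt gt' w w0 wt *.
have rw : \rank w^ir = 1%N.
  apply/eqP; rewrite eqn_leq rank_leq_col/= lt0n mxrank_eq0.
  by apply: contraNneq w0 => w0; apply/eqP/(@map_intr_inj R); rewrite w0 map_mx0.
have [sg [L [V' [P [Q [K [S [LU V'0 wE E [PU SU K1]]]]]]]]] := adapted_basis gU rw.
have Bt : separated (block_mx P Q (K *m P) (K *m Q + S)) t'.
  by rewrite -E; apply/sep_row_perm/sep_mul.
have P00 : \det P = P 0 0 by rewrite det_mx11.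
have latP z i : lat P z i 0 = P 0 0 * (z 0 0)%:~R.
  by rewrite /lat mxE big_ord1 mxE ord1.
have P1 : `|P 0 0| <= 4 / 3 * t'.
  have wt' i j : `|(g *m w^ir) i j| <= 4 / 3 * t' by rewrite ord1; exact: wt.
  have := adapted_basis_short wt' wE E 0 0.
  rewrite mxE big_ord1 mxE normrM -intr_norm; apply: le_trans.
  rewrite ler_peMr// ler1z -gtz0_ge1 normr_gt0.
  by apply: contraNneq V'0 => V'0; rewrite det_mx11 V'0.
have P2 : t' <= `|P 0 0|.
  have [|i] := sep_block_ul K1 (ltn0Sn 0) t'0 Bt (z := 1%:M).
    by apply/eqP => /matrixP/(_ 0 0); rewrite !mxE.
  by rewrite latP mxE/= mulr1 divr1.
have reach (v : 'cV[R]_1) : exists z, forall i, `|(v + lat P z) i 0| <= 2 / 3 * t'.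
  have P0 : P 0 0 != 0 by rewrite -normr_gt0; apply: lt_le_trans P2.
  have [m mP] := nearest_int (v 0 0 / P 0 0).
  exists (- m)%:M => i; rewrite mxE latP ord1 mxE/= mulr1n rmorphN/= mulrN.
  have -> : v 0 0 - P 0 0 * m%:~R = P 0 0 * (v 0 0 / P 0 0 - m%:~R) by field.
  rewrite normrM; apply: le_trans (ler_pM _ _ P1 mP) _ => //.
  by lra.
have St : separated S (t' / 3).
  apply: sep_le (sep_block_dr K1 _ reach _ (t := t')) => //; first lra.
    by lra.
  move=> z1 z2 z20; apply: Bt; apply: contraNneq z20 => /eqP.
  by rewrite col_mx_eq0 => /andP[].
have t'30 : 0 < t' / 3 by rewrite divr_gt0.
have := ih S _ SU t'30 St; rewrite expr_div_n ler_pdivrMr ?exprn_gt0// => Sle.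
rewrite -(det_mul_unit g LU) -(det_row_perm _ sg) E det_block normrM P00.
rewrite [X in X <= _]exprS.
apply: (@le_trans _ _ (`|P 0 0| * (3 ^+ (d * d) * `|\det S| * 3 ^+ d))).
  by apply: ler_pM => //; [exact: ltW|rewrite exprn_ge0// ltW].
have -> : 3 ^+ ((1 + d) * (1 + d)) = 3 ^+ (d * d) * 3 ^+ d * 3 ^+ (d + 1) :> R.
  by rewrite -!exprD; congr (_ ^+ _); lia.
have h1 : 1 <= 3 ^+ (d + 1) :> R by rewrite exprn_ege1// ler1n.
rewrite -[leLHS]mul1r.
have -> : 3 ^+ (d * d) * 3 ^+ d * 3 ^+ (d + 1) * (`|P 0 0| * `|\det S|) =
  3 ^+ (d + 1) * (`|P 0 0| * (3 ^+ (d * d) * `|\det S| * 3 ^+ d)) by ring.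
by apply: ler_wpM2r => //; rewrite !mulr_ge0// exprn_ge0.
Qed.

Lemma det_le_bound d (A : 'M[R]_d) C : (forall i j, `|A i j| <= C) ->
  `|\det A| <= d`!%:R * C ^+ d.
Proof.
move=> AC; apply: le_trans (ler_norm_sum _ _ _) _.
have -> : d`!%:R * C ^+ d = \sum_(s : 'S_d) C ^+ d.
  by rewrite sumr_const card_Sn mulr_natl.
apply: ler_sum => s _; rewrite normrM normr_sign mul1r normr_prod.
have -> : C ^+ d = \prod_(i < d) C by rewrite prodr_const card_ord.
by apply: ler_prod => i _; rewrite normr_ge0 AC.
Qed.

(** Round down the coordinates of [v] in the short, independent columns of [g V]. *)
Lemma int_reach d (g : 'M[R]_d) (V : 'M[int]_d) C : g \in unitmx -> \det V != 0 ->
  (forall i j, `|(g *m V^ir) i j| <= C) ->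
  forall v, exists z, forall i, `|(v + lat g z) i 0| <= d%:R * C.
Proof.
move=> gU V0 gV v.
have VU : V^ir \in unitmx by rewrite unitmxE det_map_mx unitfE intr_eq0.
have gVU : g *m V^ir \in unitmx by rewrite unitmx_mul gU.
pose c := invmx (g *m V^ir) *m v.
exists (- (V *m \col_j Num.floor (c j 0))) => i.
rewrite latN /lat map_mxM mulmxA -{1}[v](mulKVmx gVU) -mulmxBr mxE.
apply: le_trans (ler_norm_sum _ _ _) _.
have -> : d%:R * C = \sum_(j < d) C by rewrite sumr_const card_ord mulr_natl.
apply: ler_sum => j _; rewrite normrM -[C]mulr1; apply: ler_pM => //.
rewrite !mxE -/c ler_norml.
set x := \sum_(_ <- _ | _) _; have := floor_le x; have := floorD1_gt x.
rewrite intrD => *; apply/andP; split; lra.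
Qed.

End more_lattices.

(** * Lattices with a gap between successive minima *)

Section gap.
Context {R : realType}.

Local Notation "V ^ir" := (map_mx intr V : 'M[R]_(_, _)) (at level 2, format "V ^ir").

Definition rarely_bad d (e M : R) := forall (g : 'M[R]_d) l th,
  g \in unitmx -> 0 < l -> separated g l -> (forall i, 0 <= th i <= l / M) ->
  umean (fun v => (v \in bad_shifts g th)%:R) e.

Lemma not_badP d (g : 'M[R]_d) th v : v \notin bad_shifts g th ->
  exists z, \prod_i (`|(v + lat g z) i 0| + th i) <= 2 ^- d * `|\det g|.
Proof.
move=> vb; apply: contrapT => /forallNP h; move/negP: vb; apply.
by rewrite in_setE => z; rewrite ltNge; apply/negP/h.
Qed.

(** With margins, a bound on the product bounds every single coordinate. *)
Lemma prodD_ge d (u : 'I_d -> R) a i : 0 <= a -> (forall i, 0 <= u i) ->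
  u i * a ^+ d.-1 <= \prod_i (u i + a).
Proof.
move=> a0 u0; rewrite (bigD1 i)//=; apply: ler_pM => //.
- exact: exprn_ge0.
- by rewrite lerDl.
have -> : a ^+ d.-1 = \prod_(j < d | j != i) a.
  by rewrite prodr_const cardC1 card_ord.
by apply: ler_prod => j _; rewrite a0 lerDr u0.
Qed.

(** Used contrapositively: if there are no [r + 1] short independent vectors, every lattice vector
    outside the sublattice is long. *)
Lemma has_short_extend r s (g : 'M[R]_(r + s)) (V : 'M[int]_(r + s, r))
    (L : 'M[int]_(r + s)) (V' : 'M[int]_r) (C : R) (z1 : 'cV[int]_r) (z2 : 'cV[int]_s) :
  L \in unitmx -> \det V' != 0 -> V = L *m col_mx V' 0 -> z2 != 0 ->
  (forall i j, `|(g *m V^ir) i j| <= C) ->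
  (forall i, `|lat g (L *m col_mx z1 z2) i 0| <= C) -> has_short g (r + 1) C.
Proof.
move=> LU V'0 VE z20 gV gz; exists (row_mx V (L *m col_mx z1 z2)); last first.
  move=> i j; rewrite map_row_mx mul_mx_row.
  by case: (split_ordP j) => k ->; rewrite ?row_mxEl ?row_mxEr ?[k]ord1.
have -> : row_mx V (L *m col_mx z1 z2) =
    L *m (block_mx 1%:M 0 0 z2 *m block_mx V' z1 0 1%:M).
  rewrite mulmx_block !mul1mx !mul0mx !mulmx0 mulmx1 !addr0 add0r.
  by rewrite VE -mul_mx_row -block_mxEh.
have XU : (block_mx V' z1 0 1%:M)^ir \in unitmx.
  by rewrite unitmxE det_map_mx det_ublock det1 mulr1 unitfE intr_eq0.
have LU' : L^ir \in unitmx by rewrite unitmxE det_map_mx rmorph_unit.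
rewrite !map_mxM (eqmxMfull _ (_ : row_full L^ir)) ?row_full_unit// mxrankMfree ?row_free_unit//.
rewrite map_block_mx map_mx1 !map_mx0 rank_diag_block_mx mxrank1; congr (_ + _)%N.
apply/eqP; rewrite eqn_leq rank_leq_col/= lt0n mxrank_eq0.
by apply: contraNneq z20 => z20; apply/eqP/(@map_intr_inj R); rewrite z20 map_mx0.
Qed.

Lemma umean_bad_gap r s (e1 e2 M1 M2 C : R) : (0 < r)%N -> 0 < M1 -> 0 < M2 -> 0 < C ->
  rarely_bad r e1 M1 -> rarely_bad s e2 M2 ->
  exists Cn M', [/\ 0 < Cn, 0 < M' & forall (g : 'M[R]_(r + s)) t th,
    g \in unitmx -> 0 < t -> separated g t -> (forall i, 0 <= th i <= t / M') ->
    has_short g r (C * t) -> ~ has_short g (r + 1) (Cn * t) ->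
    umean (fun v => (v \in bad_shifts g th)%:R) (e1 + e2)].
Proof.
move=> r0 M10 M20 C0 Q1 Q2; have rR : 0 < r%:R :> R by rewrite ltr0n.
(* [U * t] bounds each coordinate of a good point of the fiber: divide [|det P| <= r! (C t) ^ r] by
   the remaining [r - 1] margins [t / r / M1]. *)
pose U : R := r`!%:R * C ^+ r * (r%:R * M1) ^+ r.-1.
have U0 : 0 <= U by rewrite /U !mulr_ge0// exprn_ge0// ?ltW// mulr_gt0.
(* The second summand pays for lifting quotient vectors. The third makes the margin [l / M2] of the
   quotient at least [(r U + 1) t], enough for the coupling [|K u| <= r U t] and for the margin
   [th <= t] itself. *)
pose Cn := C + r%:R * r%:R * C + M2 * (r%:R * U + 1).
pose M' := r%:R * M1 + 1.
have rrC : 0 <= r%:R * r%:R * C by rewrite !mulr_ge0 // ltW.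
have rU1 : 0 < r%:R * U + 1 by rewrite ltr_wpDl// mulr_ge0 // ltW.
have rU : 0 < M2 * (r%:R * U + 1) by rewrite mulr_gt0.
have Cn0 : 0 < Cn by rewrite /Cn; lra.
have M'1 : 1 < M' by rewrite ltrDr mulr_gt0.
exists Cn, M'; split => // [|g t th gU t0 gt thb [V rV gV] nshort]; first lra.
have [sg [L [V' [P [Q [K [S [LU V'0 VE E [PU SU K1]]]]]]]]] := adapted_basis gU rV.
set B := block_mx _ _ _ _ in E.
have Bt : separated B t by rewrite -E; apply/sep_row_perm/sep_mul.
have PV' := adapted_basis_short gV VE E.
have reach := int_reach PU V'0 PV'.
have Pt := sep_block_ul K1 r0 t0 Bt.
have St : separated S (Cn * t - r%:R * (r%:R * (C * t))).
  apply: (sep_block_dr (Q := Q) K1 _ reach) => [|z1 z2 z20].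
    rewrite mulrA ltr_pM2r// /Cn -addrA ltr_pwDl//.
    have : r%:R * C <= r%:R * r%:R * C.
      by rewrite ler_pM2r// ler_peMr ?ler1n// ltW.
    lra.
  apply: contrapT => /forallNP h; apply: nshort.
  apply: (has_short_extend (z1 := z1) LU V'0 VE z20) => [i j|i].
    apply: le_trans (gV i j) _; rewrite ler_pM2r// /Cn -addrA lerDl.
    by rewrite addr_ge0// ltW.
  have := h ((sg^-1)%g i); rewrite -/B -E lat_row_perm mxE permKV lat_mul.
  by move=> /negP; rewrite -ltNge => /ltW.
have l1 : 0 < t / r%:R by rewrite divr_gt0.
have l2 : r%:R * U + 1 = (Cn * t - r%:R * (r%:R * (C * t)) - C * t) / M2 / t.
  by rewrite /Cn; field; rewrite !gt_eqF.
set l := Cn * t - r%:R * (r%:R * (C * t)) in St l2.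
have l0 : 0 < l.
  rewrite (_ : l = (C + M2 * (r%:R * U + 1)) * t) ?mulr_gt0//; last first.
    by rewrite /l /Cn; ring.
  by rewrite addr_gt0.
have lU : (r%:R * U + 1) * t <= l / M2.
  rewrite l2 divfK ?gt_eqF// ler_pM2r ?invr_gt0// gerBl.
  by rewrite mulr_ge0 ?ltW.
have := Q1 P _ (fun=> t / r%:R / M1) PU l1 Pt (fun i => _).
have := Q2 S _ (fun=> l / M2) SU l0 St (fun i => _).
rewrite !lexx !andbT !divr_ge0 ?ltW// => /(_ (fun=> isT)) u2 /(_ (fun=> isT)) u1.
(* [z2] depends only on the image in the quotient, so [phi1] commutes with
     translations along the graph of [K], on which [phi2] is constant. *)
pose z2 y := xget 0 [set z | \prod_i (`|(y + lat S z) i 0| + l / M2) <= 2 ^- s * `|\det S|].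
pose phi2 (v : 'cV[R]_(r + s)) := dsubmx (row_perm sg v) - K *m usubmx (row_perm sg v).
pose phi1 (v : 'cV[R]_(r + s)) := usubmx (row_perm sg v) + lat Q (z2 (phi2 v)).
have permD (v w : 'cV[R]_(r + s)) : row_perm sg (v + row_perm sg^-1%g w) = row_perm sg v + w.
  by apply/matrixP => i j; rewrite !mxE permK.
have {}u2 : umean (fun v => (phi2 v \in bad_shifts S (fun=> l / M2))%:R) e2.
  apply: (umean_pull (phi := phi2) (psi := fun y => row_perm sg^-1%g (col_mx 0 y))) u2 => v y.
  rewrite /phi2 permD !linearD/= col_mxKu col_mxKd linear0 oppr0 addr0.
  by rewrite addrAC.
have {}u1 : umean (fun v => (phi1 v \in bad_shifts P (fun=> t / r%:R / M1))%:R) e1.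
  apply: (umean_pull (phi := phi1)
    (psi := fun y => row_perm sg^-1%g (col_mx y (K *m y)))) u1 => v y.
  rewrite /phi1; have -> : phi2 (v + row_perm sg^-1%g (col_mx y (K *m y))) = phi2 v.
    rewrite /phi2 permD !linearD/= col_mxKu col_mxKd.
    by rewrite addrACA subrr addr0.
  by rewrite permD linearD/= col_mxKu addrAC.
(* If neither [phi1 v] is bad for [P] nor [phi2 v] bad for [S], the two witnesses combine into one
   for [v]. *)
apply: umean_le (umeanD u1 u2) => // v.
have [|/not_badP[z1 z1P]] := boolP (phi1 v \in _).
  by move=> _; rewrite -[leLHS]addr0 lerD// ler_nat; case: (v \in _).
have [|/not_badP z2P'] := boolP (phi2 v \in _).
  by move=> _; rewrite add0r ler_nat; case: (v \in _).
have {z2P'}z2P : \prod_i (`|(phi2 v + lat S (z2 (phi2 v))) i 0| + l / M2) <= 2 ^- s * `|\det S|.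
  by have [z zP] := z2P'; rewrite /z2; case: xgetP => [w -> //|/(_ z)].
rewrite addr0 (_ : v \in _ = false)//; apply/negP; rewrite in_setE.
move=> /(_ (L *m col_mx z1 (z2 (phi2 v)))); apply/negP; rewrite -leNgt.
set u := phi1 v + lat P z1 in z1P.
set y := phi2 v + lat S _ in z2P.
have vE : row_perm sg (v + lat g (L *m col_mx z1 (z2 (phi2 v)))) = col_mx u (K *m u + y).
  rewrite -lat_mul linearD/= -lat_row_perm E lat_block -{1}[row_perm sg v]vsubmxK add_col_mx.
  congr col_mx; rewrite /u /y /phi1 /phi2.
    by rewrite -addrA [_ + lat P _]addrC.
  rewrite !mulmxDr; set z := z2 _; move: (K *m _) (K *m _) (K *m _) (lat S z) (dsubmx _).
  by move=> a b c e f; apply/matrixP => i j; rewrite !mxE; ring.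
have -> : \prod_i (`|(v + lat g (L *m col_mx z1 (z2 (phi2 v)))) i 0| + th i) =
    \prod_i (`|(col_mx u (K *m u + y)) i 0| + th (sg i)).
  rewrite (reindex_inj (@perm_inj _ sg)) -vE.
  by apply: eq_bigr => i _; rewrite [in RHS]mxE.
have dg : 2 ^- (r + s) * `|\det g| = (2 ^- r * `|\det P|) * (2 ^- s * `|\det S|).
  rewrite -(det_mul_unit g LU) -(det_row_perm _ sg) E det_block normrM.
  by rewrite exprD invfM mulrACA.
rewrite big_split_ord dg.
have th1 i : 0 <= th i <= t / r%:R / M1.
  have /andP[-> h]/= := thb i; apply: le_trans h _.
  by rewrite -mulrA -invfM ler_pM2l// lef_pV2 ?posrE ?mulr_gt0 ?(lt_trans ltr01 M'1)// /M' lerDl.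
have a0 : 0 < t / r%:R / M1 by rewrite divr_gt0.
have Ui i : `|u i 0| <= U * t.
  have := le_trans (prodD_ge i (ltW a0) (fun i => normr_ge0 (u i 0))) z1P.
  (* [V'] is an integer matrix with nonzero determinant, so [|det P|] is at most [|det (P V')|],
     whose columns are short. *)
  have dP : 2 ^- r * `|\det P| <= r`!%:R * (C * t) ^+ r.
    apply: le_trans (det_le_bound PV').
    rewrite det_mulmx det_map_mx normrM mulrC; apply: ler_wpM2l => //.
    apply: (@le_trans _ _ 1); first by rewrite invf_le1 ?exprn_gt0// exprn_ege1// ler1n.
    by rewrite -intr_norm ler1z -gtz0_ge1 normr_gt0.
  move=> /le_trans/(_ dP) ua; rewrite -(ler_pM2r (exprn_gt0 r.-1 a0)).
  apply: le_trans ua _; apply/eq_ler.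
  have -> : U * t * (t / r%:R / M1) ^+ r.-1 =
      r`!%:R * C ^+ r * t * (r%:R * M1 * (t / r%:R / M1)) ^+ r.-1.
    by rewrite [in RHS]exprMn /U; move: (_ ^+ r.-1) (_ ^+ r.-1) => x y'; ring.
  have -> : r%:R * M1 * (t / r%:R / M1) = t by field; rewrite !gt_eqF.
  by rewrite -mulrA -exprS prednK// exprMn mulrA.
apply: ler_pM.
- by apply: prodr_ge0 => i _; have /andP[? _] := thb (sg (lshift s i)); rewrite addr_ge0.
- by apply: prodr_ge0 => i _; have /andP[? _] := thb (sg (rshift r i)); rewrite addr_ge0.
- apply: le_trans z1P; apply: ler_prod => i _; rewrite col_mxEu.
  by have /andP[? h] := th1 (sg (lshift s i)); rewrite addr_ge0//= lerD2l.
apply: le_trans z2P; apply: ler_prod => i _; rewrite col_mxEd.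
have /andP[tha thb'] := thb (sg (rshift r i)); rewrite addr_ge0//=.
rewrite mxE; apply: le_trans (lerD (ler_normD _ _) thb') _.
rewrite addrAC addrC lerD2l; apply: le_trans lU; rewrite mulrDl mul1r.
apply: lerD; first by rewrite -mulrA; exact: mulmx_le1.
by rewrite ler_pdivrMr ?(lt_trans ltr01)// ler_peMr ?ltW.
Qed.

End gap.

(** * Climbing the successive minima, diagonal stretchings, and dimension one *)

Section uniform.
Context {R : realType}.

Local Notation "V ^ir" := (map_mx intr V : 'M[R]_(_, _)) (at level 2, format "V ^ir").

(** Induction on [k], starting from the short vector [w]. With [k] short vectors, either a further
    one exists at a larger constant, or there is a gap after rank [k] and [umean_bad_gap] applies
    with [e / 2] for each factor. *)
Lemma umean_bad_or_short d (e : R) : 0 < e ->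
  (forall r, (0 < r < d)%N -> forall e : R, 0 < e -> exists2 M, 0 < M & rarely_bad r e M) ->
  forall k, (0 < k <= d)%N -> exists C M' : R, [/\ 0 < C, 0 < M' &
  forall (g : 'M[R]_d) t th, g \in unitmx -> 0 < t -> separated g t ->
    (exists2 w, w != 0 & forall i, `|lat g w i 0| <= 2 * t) ->
    (forall i, 0 <= th i <= t / M') ->
    umean (fun v => (v \in bad_shifts g th)%:R) e \/ has_short g k (C * t)].
Proof.
move=> e0 IH k; elim: k => // k ihk /= kd; have [->|k0] := posnP k.
  exists 2, 1; split => // g t th gU t0 gt [w w0 wt] _; right; exists w.
    apply/eqP; rewrite eqn_leq rank_leq_col/= lt0n mxrank_eq0.
    by apply: contraNneq w0 => w0; apply/eqP/(@map_intr_inj R); rewrite w0 map_mx0.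
  by move=> i j; rewrite ord1; exact: wt.
have [|C [M' [C0 M'0 P]]] := ihk; first by rewrite k0 ltnW.
have e20 : 0 < e / 2 by rewrite divr_gt0.
have kd' : (0 < d - k < d)%N by rewrite subn_gt0 kd ltn_subrL k0 (leq_trans _ kd).
have [|M1 M10 Q1] := IH k _ _ e20; first by rewrite k0.
have [M2 M20 Q2] := IH _ kd' _ e20.
have := umean_bad_gap k0 M10 M20 C0 Q1 Q2; rewrite addn1 subnKC ?(ltnW kd)//.
move=> [Cn [M'' [Cn0 M''0 G]]].
exists Cn, (M' + M''); split => //; first by rewrite addr_gt0.
move=> g t th gU t0 gt gw thb.
have thb1 i : 0 <= th i <= t / M'.
  have /andP[-> h]/= := thb i; apply: le_trans h _.
  by rewrite ler_pM2l// lef_pV2 ?posrE ?addr_gt0// lerDl ltW.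
have thb2 i : 0 <= th i <= t / M''.
  have /andP[-> h]/= := thb i; apply: le_trans h _.
  by rewrite ler_pM2l// lef_pV2 ?posrE ?addr_gt0// lerDr ltW.
have [|sk] := P g t th gU t0 gt gw thb1; first by left.
have [|ns] := pselect (has_short g k.+1 (Cn * t)); first by right.
by left; rewrite (splitr e); exact: (G g t th).
Qed.

Definition stretch d (a : 'I_d -> R) (g : 'M[R]_d) := diag_mx (\row_i a i) *m g.

Lemma stretchE d a (g : 'M[R]_d) z i : lat (stretch a g) z i 0 = a i * lat g z i 0.
Proof. by rewrite /lat /stretch -mulmxA mul_diag_mx !mxE. Qed.

Lemma det_stretch d a (g : 'M[R]_d) : \prod_i a i = 1 -> \det (stretch a g) = \det g.
Proof.
move=> a1; rewrite det_mulmx det_diag (eq_bigr a) ?a1 ?mul1r// => i _.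
by rewrite mxE.
Qed.

Lemma covers_stretch d (a : 'I_d -> R) (g : 'M[R]_d) (c : R) : (forall i, 0 < a i) ->
  covers (stretch a g) (fun=> c) -> covers g (fun i => c / a i).
Proof.
move=> a0 gc v; have [z zP] := gc (\col_i (a i * v i 0)); exists z => i.
have := zP i; rewrite mxE stretchE mxE -mulrDr.
have -> : v i 0 + lat g z i 0 = (v + lat g z) i 0 by rewrite [RHS]mxE.
by rewrite pmulr_rge0// ler_pdivlMr// mulrC.
Qed.

(** Coordinate [i] and its margin are both multiplied by [a i], and the [a i] have product 1, so
    neither side of the inequality defining bad points changes. *)
Lemma umean_bad_stretch d (a th : 'I_d -> R) (g : 'M[R]_d) (e : R) :
  (forall i, 0 < a i) -> \prod_i a i = 1 ->
  umean (fun v => (v \in bad_shifts (stretch a g) (fun i => a i * th i))%:R) e ->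
  umean (fun v => (v \in bad_shifts g th)%:R) e.
Proof.
move=> a0 a1 u.
apply: umean_le (@umean_pull R _ _ _ _ (fun v : 'cV[R]_d => \col_i (a i * v i 0) : 'cV[R]_d)
  (fun v : 'cV[R]_d => \col_i (v i 0 / a i) : 'cV[R]_d) _ u) => // [v /=|v s]; last first.
  rewrite (_ : \col_i _ = \col_i (a i * v i 0) + s)//.
  apply/matrixP => i j; rewrite !mxE ord1 mulrDr mulrCA.
  by rewrite mulfV ?gt_eqF// mulr1.
suff -> : v \in bad_shifts g th =
  (\col_i (a i * v i 0) \in bad_shifts (stretch a g) (fun i => a i * th i)) by [].
have E z : \prod_i (`|(v + lat g z) i 0| + th i) =
    \prod_i (`|(\col_i (a i * v i 0) + lat (stretch a g) z) i 0| + a i * th i).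
  rewrite -[LHS]mul1r -{1}a1 -big_split/=; apply: eq_bigr => i _.
  rewrite [in RHS]mxE stretchE [in RHS]mxE [in LHS]mxE.
  by rewrite -[in RHS]mulrDr normrM gtr0_norm// -mulrDr.
by apply/idP/idP; rewrite !in_setE => vb z; have := vb z; rewrite det_stretch// E.
Qed.

(** In units of [g 0 0], a bad point lies within [1 / (2 n)] of a half integer. Among [n] translates
    spaced by [1 / n] at most one does so, and the bad density is at most [1 / n]. *)
Lemma rarely_bad1 (e : R) : 0 < e -> exists2 M, 0 < M & rarely_bad 1 e M.
Proof.
move=> e0; have [n n0 nP] := exists_nat_divr_le 1 e0.
have nR : 0 < n%:R :> R by rewrite ltr0n.
exists (2 * n%:R); first by rewrite mulr_gt0.
move=> g l th gU l0 gl thb eta eta0.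
have lp : l <= `|g 0 0|.
  have [|i] := gl 1; first by apply/eqP => /matrixP/(_ 0 0); rewrite !mxE.
  by rewrite /lat map_mx1 mulmx1 ord1.
have p0 : 0 < `|g 0 0| by exact: lt_le_trans lp.
have p00 : g 0 0 != 0 by rewrite -normr_gt0.
exists [seq const_mx (g 0 0 * (j%:R / n%:R)) | j <- index_iota 0 n].
  by rewrite -size_eq0 size_map size_iota subn0 -lt0n.
move=> v; rewrite big_map size_map size_iota subn0 big_mkord.
pose b j := v + const_mx (g 0 0 * (j%:R / n%:R)) \in bad_shifts g th.
have badP (j : nat) : b j -> exists m : int,
    `|v 0 0 / g 0 0 + j%:R / n%:R - m%:~R - 2^-1| < (2 * n%:R)^-1.
  rewrite /b in_setE => bj; set x := _ + _.
  have [m xm] := nearest_int x.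
  have := bj (- m)%:M; rewrite big_ord1 expr1 det_mx11.
  have -> : (v + const_mx (g 0 0 * (j%:R / n%:R)) + lat g (- m)%:M) 0 0 = g 0 0 * (x - m%:~R).
    rewrite !mxE big_ord1 !mxE mulr1n rmorphN/= /x; field.
    by rewrite p00 gt_eqF.
  have /andP[_ th2] := thb 0; rewrite normrM => /lt_le_trans h.
  have {}h := h _ (lerD (lexx _) th2).
  have : 2^-1 < `|x - m%:~R| + (2 * n%:R)^-1.
    rewrite -(ltr_pM2l p0) mulrC; apply: lt_le_trans h _.
    by rewrite mulrDr lerD2l ler_pM2r ?invr_gt0 ?mulr_gt0.
  move: xm; set X := x - _; set E := (2 * n%:R)^-1 => xm Xlt.
  have E0 : 0 < E by rewrite invr_gt0 mulr_gt0.
  have [X0|X0] := leP 0 X.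
    exists m; rewrite -/X ltr_norml; move: xm Xlt; rewrite ger0_norm// => *.
    by apply/andP; split; lra.
  (* To the left of [m] the nearby half integer is [m - 1/2]. *)
  exists (m - 1); rewrite intrD opprD addrA -/X rmorphN/= opprK ltr_norml.
  by move: xm Xlt; rewrite ltr0_norm// => *; apply/andP; split; lra.
have uniq (i j : 'I_n) : b i -> b j -> i = j.
  move=> /badP[m im] /badP[m' jm']; apply/ord_inj/eqP.
  have : `|(i%:R - j%:R) / n%:R - (m - m')%:~R| < n%:R^-1 :> R.
    move: im jm'; rewrite !ltr_norml intrD rmorphN/= invfM => /andP[? ?] /andP[? ?].
    by apply/andP; split; lra.
  move=> h; have {}h : `|i%:Z - j%:Z - (m - m') * n%:Z| < 1.
    rewrite -(ltr_int R) intr_norm.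
    have -> : (i%:Z - j%:Z - (m - m') * n%:Z)%:~R =
        ((i%:R - j%:R) / n%:R - (m - m')%:~R) * n%:R :> R.
      by rewrite intrD rmorphN/= rmorphM/= intrD rmorphN/= mulrBl divfK ?gt_eqF.
    by rewrite normrM (gtr0_norm nR) -ltr_pdivlMr// div1r.
  have := ltn_ord i; have := ltn_ord j; move: h; rewrite ltr_norml => /andP[].
  move: (m - m') (i : nat) (j : nat) => q a c h1 h2 cn an.
  have acq : a%:Z - c%:Z = q * n%:Z by lia.
  suff q0 : q = 0 by move: acq; rewrite q0; lia.
  case: (ltrgtP q 0) => // q0; nia.
apply: (@le_trans _ _ 1).
  have [/existsP[j bj]|/existsPn h] := boolP [exists j : 'I_n, b j]; last first.
    by rewrite big1// => j _; have := h j; rewrite /b => /negbTE ->.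
  rewrite (bigD1 j)//= big1 ?addr0 ?lern1 ?leq_b1// => i ij.
  have [bi|/negbTE] := boolP (b i); last by rewrite /b => ->.
  by rewrite (uniq i j bi bj) eqxx in ij.
have := nP n (leqnn n); rewrite ler_pdivrMr// => /le_trans; apply.
by rewrite ler_pM2r// lerDl ltW.
Qed.

End uniform.

(** * The uniform estimate *)

Section exists_rarely_bad.
Context {R : realType}.

Local Notation "V ^ir" := (map_mx intr V : 'M[R]_(_, _)) (at level 2, format "V ^ir").

Lemma stretch_unit d (a : 'I_d -> R) g : g \in unitmx -> \prod_i a i = 1 -> stretch a g \in unitmx.
Proof. by move=> gU a1; rewrite unitmxE det_stretch// -unitmxE. Qed.

Lemma has_short_covers d (g : 'M[R]_d) C : g \in unitmx -> has_short g d C ->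
  covers g (fun=> (d%:R * C) *+ 2) /\ `|\det g| <= d`!%:R * C ^+ d.
Proof.
move=> gU [V rV gV].
have V0 : \det V != 0.
  by rewrite -(intr_eq0 R) -det_map_mx -unitfE -unitmxE -row_free_unit /row_free rV.
split; first by apply: covers_ball; exact: int_reach gU V0 gV.
apply: le_trans (det_le_bound gV); rewrite det_mulmx det_map_mx normrM.
by rewrite ler_peMr// -intr_norm ler1z -gtz0_ge1 normr_gt0.
Qed.

Lemma exists_rarely_bad d : (0 < d)%N -> forall e : R, 0 < e -> exists2 M, 0 < M & rarely_bad d e M.
Proof.
have [n] := ubnP d; elim: n d => // n ih d dn d0 e e0.
have [d1|d1] := leqP d 1.
  have -> : d = 1%N by apply/eqP; rewrite eqn_leq d1.
  exact: rarely_bad1.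
have IH r : (0 < r < d)%N -> forall e : R, 0 < e -> exists2 M, 0 < M & rarely_bad r e M.
  by move=> /andP[r0 rd]; apply: ih => //; exact: leq_trans rd _.
have [|C [M' [C0 M'0 dich]]] := umean_bad_or_short e0 IH (k := d); first by rewrite d0 leqnn.
pose c3 : R := 3 ^+ d; have c30 : 0 < c3 by exact: exprn_gt0.
pose fd : R := d`!%:R; have fd1 : 1 <= fd by rewrite ler1n fact_gt0.
have fd0 : 0 < fd by exact: lt_le_trans fd1.
(* Below, a stretching with minimum about [t] is covered by cubes of side [2 d C t], where
   [t <= c3 * fd * C * t1] and [t1 = 2 * c3 * delta]; so [k] cells of side [delta] suffice. *)
pose k := (Num.truncn (d%:R * C *+ 2 * (c3 * fd * C) * (2 * c3))).+1.
have [B B1 recur] := umean_bad_recurrent k d1 e0.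
have B0 : 0 < B by exact: lt_le_trans B1.
(* One factor [B] for the loss of separation under stretching and one for the growth of the margins;
   the second summand turns [l <= t1] into margins at most [delta / 2 / B]. *)
exists (B * B * M' + 4 * c3 * B); first by rewrite addr_gt0// !mulr_gt0.
move=> g l th gU l0 gl thb.
have M1 : B * B * M' <= B * B * M' + 4 * c3 * B by rewrite lerDl !mulr_ge0// ltW.
have M2 : 4 * c3 * B <= B * B * M' + 4 * c3 * B by rewrite lerDr !mulr_ge0// ltW.
have th1 i : 0 <= th i <= l / (B * B * M').
  have /andP[-> h]/= := thb i; apply: le_trans h _.
  by rewrite ler_pM2l// lef_pV2 ?posrE ?addr_gt0// !mulr_gt0.
have th2 i : 0 <= th i <= l / (4 * c3 * B).
  have /andP[-> h]/= := thb i; apply: le_trans h _.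
  by rewrite ler_pM2l// lef_pV2 ?posrE ?addr_gt0// !mulr_gt0.
(* One moderate stretching of small bad density settles [g]. Otherwise the dichotomy gives [d] short
   vectors in every moderate stretching. *)
have [[a [aB a1 ua]]|nua] := pselect (exists a, [/\ forall i, B^-1 <= a i <= B, \prod_i a i = 1 &
    umean (fun v => (v \in bad_shifts (stretch a g) (fun i => a i * th i))%:R) e]).
  apply: umean_bad_stretch a1 ua => i; have /andP[h _] := aB i.
  by apply: lt_le_trans h; rewrite invr_gt0.
have short a : (forall i, B^-1 <= a i <= B) -> \prod_i a i = 1 -> exists t,
    [/\ l / B <= t, separated (stretch a g) t & has_short (stretch a g) d (C * t)].
  move=> aB a1; have aU := stretch_unit gU a1.
  have a0 i : 0 < a i by have /andP[h _] := aB i; apply: lt_le_trans h; rewrite invr_gt0.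
  have ag : separated (stretch a g) (l / B).
    move=> z /gl[i li]; exists i; rewrite stretchE normrM (gtr0_norm (a0 i)) [leRHS]mulrC.
    by apply: ler_pM => //; [exact: ltW|rewrite invr_ge0 ltW|have /andP[] := aB i].
  have lB : 0 < l / B by rewrite divr_gt0.
  have [t lt [agt w]] := sep_near_min d0 lB (ltr1n R 2) ag.
  exists t; split => //; have t0 : 0 < t by exact: lt_le_trans lt.
  have [|ub|//] := dich _ t (fun i => a i * th i) aU t0 agt w.
    move=> i; have /andP[? thi] := th1 i; have /andP[_ ai] := aB i.
    rewrite mulr_ge0 ?(ltW (a0 i))//=.
    apply: (@le_trans _ _ (B * (l / (B * B * M')))).
      by apply: ler_pM => //; exact: ltW.
    have -> : B * (l / (B * B * M')) = l / B / M' by field; rewrite !gt_eqF.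
    by rewrite ler_pM2r ?invr_gt0.
  by case: nua; exists a.
have [t1 lt1 [gt1 w1]] := sep_near_min d0 l0 (ltr1n R 2) gl.
have t10 : 0 < t1 by exact: lt_le_trans lt1.
have [|//|sh1] := dich g t1 th gU t10 gt1 w1.
  move=> i; have /andP[-> h]/= := th1 i; apply: le_trans h _.
  apply: ler_pM => //; rewrite ?invr_ge0 ?(ltW l0) ?mulr_ge0 ?(ltW B0) ?(ltW M'0)//.
  rewrite lef_pV2 ?posrE ?mulr_gt0// ler_peMl ?(ltW M'0)//.
  by rewrite mulr_ege1.
have c3d : 3 ^+ (d * d) = c3 ^+ d :> R by rewrite exprM.
have [_ detg] := has_short_covers gU sh1.
(* By [det_ge_sep], [t1 ^ d <= c3 ^ d * |det g|]; dividing by [(2 * c3) ^ d] gives the side product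
   allowed for a box. *)
pose delta := t1 / (2 * c3).
have delta0 : 0 < delta by rewrite divr_gt0// mulr_gt0.
apply: (recur g delta th gU delta0).
- move=> a aB a1; have [t [lt agt sha]] := short a aB a1.
  have aU := stretch_unit gU a1.
  have a0 i : 0 < a i by have /andP[h _] := aB i; apply: lt_le_trans h; rewrite invr_gt0.
  have t0 : 0 < t by apply: lt_le_trans lt; rewrite divr_gt0.
  have [cov _] := has_short_covers aU sha.
  apply: covers_le (covers_stretch a0 cov) => i.
  rewrite [leRHS]mulrA ler_pM2r ?invr_gt0//.
  (* Stretching preserves the determinant, which bounds [t ^ d] from above for the stretched lattice
     and is itself bounded by the short vectors of [g]. Hence a single [delta] fits all
     stretchings. *)
  have tle : t <= c3 * fd * C * t1.
    have X0 : 0 < c3 * fd * C * t1 by rewrite !mulr_gt0.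
    rewrite -(ler_pXn2r d0) ?nnegrE ?(ltW X0) ?(ltW t0)//.
    apply: le_trans (det_ge_sep aU t0 agt) _; rewrite det_stretch// c3d.
    rewrite -!mulrA exprMn ler_pM2l ?exprn_gt0//; apply: le_trans detg _.
    rewrite [leRHS]exprMn ler_pM2r ?exprn_gt0 ?mulr_gt0//.
    by rewrite -/fd -{1}[fd]expr1 ler_weXn2l.
  have kP : d%:R * C *+ 2 * (c3 * fd * C) * (2 * c3) <= k%:R by exact/ltW/truncnS_gt.
  apply: le_trans (ler_wpM2r (ltW delta0) kP).
  have -> : d%:R * C *+ 2 * (c3 * fd * C) * (2 * c3) * delta = d%:R * C *+ 2 * (c3 * fd * C * t1).
    by rewrite /delta; field; rewrite gt_eqF.
  have -> : d%:R * (C * t) *+ 2 = d%:R * C *+ 2 * t by ring.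
  by apply: ler_wpM2l => //; rewrite mulrn_wge0// mulr_ge0// ltW.
- move=> i; have /andP[-> h]/= := th2 i; apply: le_trans h _.
  have -> : delta / 2 / B = t1 / (4 * c3 * B) by rewrite /delta; field; rewrite !gt_eqF.
  by rewrite ler_pM2r// invr_gt0 !mulr_gt0.
rewrite /delta expr_div_n exprMn ler_pdivrMr ?mulr_gt0 ?exprn_gt0//.
have -> : 2 ^- d * `|\det g| * (2 ^+ d * c3 ^+ d) = c3 ^+ d * `|\det g|.
  by rewrite mulrACA mulVf ?expf_neq0 ?pnatr_eq0// mul1r mulrC.
by rewrite -c3d; exact: det_ge_sep.
Qed.

End exists_rarely_bad.

(** * Periodic null sets *)

Section translation.
Context {R : realType}.
Local Notation T := (measurableTypeR R).
Local Notation lebn := (@lebesgue_measure_tuple R).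

Lemma lebesgue_measure_shift (a : R) (A : set T) : measurable A ->
  lebesgue_measure ((fun x : T => x + a : T) @^-1` A) = lebesgue_measure A.
Proof.
have ma : measurable_fun [set: T] (fun x : T => x + a : T).
  by apply: measurable_funD => //.
move=> mA; rewrite [RHS](@lebesgue_measure_unique _
  (measure_function_pushforward__canonical__measure_function_Measure (@lebesgue_measure R) ma))//.
move=> _ [[c b]] _ <- /=; rewrite /pushforward.
rewrite (_ : _ @^-1` _ = `]c - a, b - a]%classic); last first.
  by apply/seteqP; split => x /=; rewrite !in_itv/= ltrBlDr lerBrDr.
by rewrite !lebesgue_measure_itv/= !lte_fin ltrD2r -!EFinB opprB addrA subrK.
Qed.

Definition tshift n (a : 'I_n -> R) (t : n.-tuple T) : n.-tuple T :=
  [tuple tnth t i + a i | i < n].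

Lemma measurable_tshift n (a : 'I_n -> R) : measurable_fun setT (tshift a).
Proof.
apply/measurable_fun_tnthP => i.
rewrite (_ : _ \o _ = fun t : n.-tuple T => tnth t i + a i); last first.
  by apply/funext => t /=; rewrite tnth_mktuple.
by apply: measurable_funD => //; exact: measurable_tnth.
Qed.

Lemma lebesgue_measure_tuple_shift n (a : 'I_n -> R) (A : set (n.-tuple T)) :
  measurable A -> lebn n (tshift a @^-1` A) = lebn n A.
Proof.
elim: n a A => [|n ih] a A mA.
  congr (lebn 0 _); apply/seteqP; split => t /=; by rewrite (tuple0 (tshift a t)) (tuple0 t).
pose phi (p : T * n.-tuple T) : T * n.-tuple T :=
  (p.1 + a ord0, tshift (fun i => a (lift ord0 i)) p.2).
have mphi : measurable_fun setT phi.
  apply: measurable_fun_pair => /=.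
    by apply: measurable_funD => //.
  by apply: measurableT_comp => //; exact: measurable_tshift.
have mcA : measurable (@tcons R n @^-1` A).
  by rewrite -[X in measurable X]setTI; exact: measurable_tcons.
rewrite /= /lebesgue_cons /pushforward.
rewrite (_ : _ @^-1` (tshift a @^-1` A) = phi @^-1` (@tcons R n @^-1` A)); last first.
  have E p : tshift a (tcons p) = tcons (phi p).
    apply/eq_from_tnth => i; rewrite tnth_mktuple.
    by case: (unliftP ord0 i) => [j|] ->; rewrite ?tnthS ?tnth0 ?tnth_mktuple.
  by apply/seteqP; split => p /=; rewrite E.
rewrite [RHS](@product_measure_unique _ _ _ _ _ _ _
  (measure_function_pushforward__canonical__measure_function_Measure
    ((@lebesgue_measure R) \x (lebn n))%E mphi))//.
move=> B C mB mC /=; rewrite /pushforward.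
rewrite (_ : _ @^-1` _ = ((fun x : T => x + a ord0 : T) @^-1` B) `*`
    (tshift (fun i => a (lift ord0 i)) @^-1` C))//.
have mB' : measurable ((fun x : T => x + a ord0 : T) @^-1` B).
  rewrite -[X in measurable X]setTI; apply: (_ : measurable_fun setT _) => //.
  by apply: measurable_funD.
have mC' : measurable (tshift (fun i => a (lift ord0 i)) @^-1` C).
  by rewrite -[X in measurable X]setTI; apply: measurable_tshift.
by rewrite product_measure1E// ih//; congr (_ * _)%E; exact: lebesgue_measure_shift.
Qed.

End translation.

Section periodic.
Context {R : realType} {d : nat} (x : lattice R d).
Local Notation T := (measurableTypeR R).
Local Notation g := (lattice_basis x).
Local Notation mu := (@lebesgue_measure_tuple R d).
Local Notation F := (@vec R d @^-1` fundamental_domain x).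

Lemma lattice_basis_unit : g \in unitmx.
Proof. by rewrite unitmxE det_lattice_basis unitr1. Qed.

Lemma fundamental_domain_cover v : exists z, fundamental_domain x (v + lat g z).
Proof.
exists (- \col_i Num.floor ((invmx g *m v) i 0)).
exists (invmx g *m v - map_mx intr (\col_i Num.floor ((invmx g *m v) i 0))).
  move=> i; set y := (X in 0 <= X < 1).
  have -> : y = (invmx g *m v) i 0 - (Num.floor ((invmx g *m v) i 0))%:~R.
    by rewrite /y !mxE.
  rewrite subr_ge0 floor_le ltrBlDl /=; have := floorD1_gt ((invmx g *m v) i 0).
  by rewrite intrD.
by rewrite latN mulmxBr mulKVmx ?lattice_basis_unit.
Qed.

Lemma fundamental_domain_inj v z : fundamental_domain x v ->
  fundamental_domain x (v + lat g z) -> z = 0.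
Proof.
move=> [u u01 <-] [w w01]; rewrite /lat -mulmxDr => /(can_inj (mulKmx lattice_basis_unit)) wE.
apply/matrixP => i j; rewrite ord1 mxE; have := u01 i; have := w01 i.
rewrite wE !mxE => /andP[? ?] /andP[? ?].
have : -1 < (z i 0)%:~R :> R by lra.
have : (z i 0)%:~R < 1 :> R by lra.
rewrite ltrz1 -(@intrN R 1) ltr_int; lia.
Qed.

Lemma vec_tshift (a : 'I_d -> R) t : vec (tshift a t) = vec t + \col_i a i.
Proof. by apply/matrixP => i j; rewrite !mxE tnth_mktuple. Qed.

Let mF : measurable F. Proof. exact: measurable_fundamental_domain. Qed.

Let mshift (a : 'I_d -> R) A : measurable A -> measurable (tshift a @^-1` A).
Proof. by move=> mA; rewrite -[X in measurable X]setTI; exact: measurable_tshift. Qed.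

(** Cut [E] within [F] into the pieces [G z] on which [t - a + lat g z] returns to [F]. Moving each
    piece accordingly keeps its measure, and the images are disjoint subsets of the right-hand
    set. *)
Lemma periodic_shift_ge (E : set 'cV[R]_d) (a : 'I_d -> R) :
  measurable (@vec R d @^-1` E) -> (forall v z, E (v + lat g z) <-> E v) ->
  (mu ((@vec R d @^-1` E) `&` F) <= mu (tshift a @^-1` (@vec R d @^-1` E) `&` F))%E.
Proof.
move=> mE pE; set E' := _ @^-1` E in mE *.
pose b (z : 'cV[int]_d) i := - a i + lat g z i 0.
pose G z := E' `&` F `&` tshift (b z) @^-1` F.
pose H n := if pickle_inv n is Some z then G z else set0.
pose H' n := if pickle_inv n is Some z then tshift (fun i => - b z i) @^-1` (G z) else set0.
have mG z : measurable (G z) by apply: measurableI; [exact: measurableI|exact: mshift].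
have mH n : measurable (H n) by rewrite /H; case: pickle_inv.
have mH' n : measurable (H' n) by rewrite /H'; case: pickle_inv => // z; exact: mshift.
apply: (@le_trans _ _ (\sum_(n <oo) mu (H n))%E).
  apply: measure_sigma_subadditive => //; first exact: measurableI.
  move=> t [Et Ft].
  have [z zF] := fundamental_domain_cover (vec t - \col_i a i).
  exists (pickle z) => //; rewrite /H pickleK_inv; split => //=.
  rewrite vec_tshift (_ : vec t + _ = vec t - \col_i a i + lat g z)//.
  by apply/matrixP => i j; rewrite /b !mxE ord1; ring.
have -> : (\sum_(n <oo) mu (H n) = \sum_(n <oo) mu (H' n))%E.
  apply: eq_eseriesr => n _; rewrite /H /H'; case: pickle_inv => [z|//].
  by rewrite lebesgue_measure_tuple_shift.
have sub z t : (tshift (fun i => - b z i) @^-1` (G z)) t ->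
    [/\ E' (tshift a t), F t & fundamental_domain x (vec t + \col_i a i - lat g z)].
  rewrite /G /= => -[[Et Ft] Ft2].
  have E1 : vec t + \col_i - b z i = vec t + \col_i a i - lat g z.
    by apply/matrixP => i j; rewrite /b !mxE ord1; ring.
  split.
  - by move: Et; rewrite /E' /= !vec_tshift E1 -latN pE.
  - move: Ft2; rewrite /= !vec_tshift (_ : vec t + _ + _ = vec t)//.
    by apply/matrixP => i j; rewrite !mxE subrK.
  - by move: Ft; rewrite vec_tshift E1.
rewrite -measure_semi_bigcup//.
- apply: le_measure; rewrite ?inE.
  + exact: bigcupT_measurable.
  + by apply: measurableI => //; exact: mshift.
  + by move=> t [n _]; rewrite /H'; case: pickle_inv => // z /sub[].
- apply/trivIsetP => i j _ _ ij; apply/seteqP; split => // t [].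
  have := @pickle_invK 'cV[int]_d j; have := @pickle_invK 'cV[int]_d i; rewrite /H'.
  case: pickle_inv => // z /= zi; case: pickle_inv => // w /= wj.
  move=> /sub[_ _ tz] /sub[_ _ tw]; case/negP: ij; apply/eqP.
  have : z - w = 0.
    apply: (fundamental_domain_inj tz).
    by rewrite latD latN addrA subrK.
  by move=> /eqP; rewrite subr_eq0 => /eqP zw; rewrite -zi -wj zw.
- exact: bigcupT_measurable.
Qed.

Lemma fundamental_domain_finite : (mu F < +oo)%E.
Proof.
pose K : R := \sum_i \sum_j `|g i j|.
have K0 : 0 <= K by apply: sumr_ge0 => i _; exact: sumr_ge0.
apply: (@le_lt_trans _ _ (mu [set t | forall i : 'I_d, `[- K, K]%classic (tnth t i)])).
  apply: le_measure; rewrite ?inE//.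
    rewrite (_ : [set _ | _] = \bigcap_(i in [set: 'I_d])
      (fun t : d.-tuple T => tnth t i) @^-1` `[- K, K]%classic); last first.
      by apply/seteqP; split => t /= h i; [move=> _; exact: h|exact: (h i I)].
    apply: fin_bigcap_measurable => // i _; rewrite -[X in measurable X]setTI.
    exact: measurable_tnth.
  move=> t [u u01 tu] i /=; rewrite in_itv/= -ler_norml.
  have -> : tnth t i = vec t i 0 by rewrite mxE.
  rewrite -tu mxE; apply: le_trans (ler_norm_sum _ _ _) _.
  rewrite /K [leRHS](bigD1 i)//= -[leLHS]addr0 lerD//; last first.
    by apply: sumr_ge0 => k _; exact: sumr_ge0.
  apply: ler_sum => j _; have /andP[u0 u1] := u01 j.
  by rewrite normrM ler_piMr// ger0_norm// ltW.
rewrite (@lebesgue_measure_tuple_box R d (fun=> `[- K, K]%classic))//.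
suff : \big[*%E/1%E]_(i < d) lebesgue_measure (`[- K, K]%classic : set T) \is a fin_num.
  by rewrite fin_numElt => /andP[].
apply: (big_ind (fun y : \bar R => y \is a fin_num)) => // [y z yf zf|i _].
  exact: fin_numM.
by rewrite lebesgue_measure_itv/=; case: ifP.
Qed.

(** Sum the shift inequality over the averaging list [s] and exchange sum and integral: the
    integrand counts the translates of a point lying in [E], which is small at every point. *)
Lemma periodic_null (E : set 'cV[R]_d) :
  measurable (@vec R d @^-1` E) -> (forall v z, E (v + lat g z) <-> E v) ->
  (forall e : R, 0 < e -> umean (fun v => (v \in E)%:R) e) ->
  mu ((@vec R d @^-1` E) `&` F) = 0%E.
Proof.
move=> mE pE uE; set E' := _ @^-1` E in mE *.
have mEF : measurable (E' `&` F) by exact: measurableI.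
have EFoo : (mu (E' `&` F) < +oo)%E.
  by apply: le_lt_trans fundamental_domain_finite; apply: le_measure; rewrite ?inE.
have Ff : mu F \is a fin_num by rewrite ge0_fin_numE// fundamental_domain_finite.
have EFf : mu (E' `&` F) \is a fin_num by rewrite ge0_fin_numE.
apply/eqP; rewrite eq_le measure_ge0 andbT; apply/lee_addgt0Pr => e e0; rewrite add0e.
pose M := fine (mu F); have M0 : 0 <= M by exact: fine_ge0.
(* Used twice, as the upper mean and as its slack, whence the factor 2; [M + 1] avoids division by
   zero. *)
pose e' := e / 2 / (M + 1).
have e'0 : 0 < e' by rewrite !divr_gt0// ltr_wpDl.
have [s s0 sE] := uE e' e'0 e' e'0.
have n0 : 0 < (size s)%:R :> R by rewrite ltr0n lt0n size_eq0.
pose shift (a : 'cV[R]_d) := tshift (fun i => a i 0).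
have step : (\sum_(a <- s) mu (E' `&` F) <= \sum_(a <- s) mu (shift a @^-1` E' `&` F))%E.
  by apply: lee_sum => a _; exact: periodic_shift_ge.
have sumE : (\sum_(a <- s) mu (shift a @^-1` E' `&` F) =
    \int[mu]_(t in F) \sum_(a <- s) (\1_(shift a @^-1` E') t)%:E)%E.
  rewrite ge0_integral_sum//.
    by apply: eq_bigr => a _; rewrite integral_indic//; exact: mshift.
  by move=> a; apply/measurable_EFinP/measurable_indic; exact: mshift.
have intle : (\int[mu]_(t in F) \sum_(a <- s) (\1_(shift a @^-1` E') t)%:E <=
    \int[mu]_(t in F) (cst ((e' + e') * (size s)%:R)%:E) t)%E.
  apply: ge0_le_integral => //.
  - by move=> t _; apply: sume_ge0 => a _; rewrite lee_fin.
  - apply: emeasurable_sum => a; apply/measurable_EFinP/measurable_indic; exact: mshift.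
  - move=> t _; rewrite sumEFin lee_fin /cst; apply: le_trans (sE (vec t)).
    apply/eq_ler/eq_bigr => a _; rewrite indicE; congr (nat_of_bool _)%:R.
    apply/idP/idP; rewrite !in_setE /E' /shift /= vec_tshift.
    - by rewrite (_ : \col_i a i 0 = a)//; apply/matrixP => i j; rewrite !mxE ord1.
    - by rewrite (_ : \col_i a i 0 = a)//; apply/matrixP => i j; rewrite !mxE ord1.
have := le_trans step (eq_ind_r (fun y => (y <= _)%E) intle sumE).
have -> : (\int[mu]_(t in F) (cst ((e' + e') * (size s)%:R)%:E) t =
    ((e' + e') * (size s)%:R * M)%:E)%E.
  by rewrite integral_cst// [RHS]EFinM /M fineK.
have [m ->] : exists m : R, mu (E' `&` F) = m%:E by exists (fine (mu (E' `&` F))); rewrite fineK.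
rewrite sumEFin !lee_fin.
rewrite sumr_const_seq mulrAC ler_pM2r// => h; apply: le_trans h _.
have -> : e' + e' = e / (M + 1) by rewrite /e'; field; rewrite gt_eqF// ltr_wpDl.
by rewrite mulrAC ler_pdivrMr ?ltr_wpDl// ler_pM2l// lerDl.
Qed.

End periodic.

(** * From exceptional points to grids in a fiber *)

Section conclusion.
Context {R : realType} {d : nat} (x : lattice R d).
Local Notation g := (lattice_basis x).
Local Notation T := (measurableTypeR R).

Definition exceptional : set 'cV[R]_d :=
  [set v | forall z, 2 ^- d < `|coordinate_product (v + lat g z)|].

Lemma not_minkowski v :
  ~ minkowski_conjecture (lattice_translate x v) <-> exceptional v.
Proof.
rewrite /minkowski_conjecture /exceptional; split => [nm z|ex [a [[_ [w xw <-]] <-]]].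
  rewrite ltNge; apply/negP => Nz; apply: nm.
  exists (coordinate_product (v + lat g z)); split; last first.
    by rewrite /= in_itv/= -ler_norml.
  exists (v + lat g z) => //; exists (lat g z); last by rewrite addrC.
  by rewrite int_span_lattice_basis; exists z.
move: xw; rewrite int_span_lattice_basis => -[z _ <-].
by rewrite /= in_itv/= -ler_norml addrC leNgt ex.
Qed.

Lemma exceptional_lat v z : exceptional (v + lat g z) <-> exceptional v.
Proof.
split=> h w; last by have := h (z + w); rewrite latD addrA.
by have := h (w - z); rewrite -addrA -latD (addrC z) subrK.
Qed.

Lemma measurable_exceptional : measurable (@vec R d @^-1` exceptional).
Proof.
pose f z (t : d.-tuple T) : R := coordinate_product (vec t + lat g z).
have mf z : measurable_fun setT (f z).
  rewrite /f /coordinate_product.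
  rewrite (_ : (fun t => _) = fun t : d.-tuple T => \prod_(i < d) (tnth t i + lat g z i 0)).
    apply: measurable_prod => i _; apply: measurable_funD => //.
    exact: measurable_tnth.
  by apply/funext => t; apply: eq_bigr => i _; rewrite [LHS]mxE mxE.
pose H n := if pickle_inv n is Some z then
  [set t | 2 ^- d < `|f z t|] else [set: d.-tuple T].
rewrite (_ : _ @^-1` _ = \bigcap_n H n).
  apply: bigcap_measurable => // n _; rewrite /H; case: pickle_inv => [z|//].
  rewrite -[X in measurable X]setTI (_ : [set t | _] =
    (fun t => `|f z t|) @^-1` `]2 ^- d, +oo[%classic).
    by apply: measurableT_comp => //.
  by apply/seteqP; split => t /=; rewrite in_itv/= andbT.
apply/seteqP; split => [t h n _|t h z].
  by rewrite /H; case: pickle_inv => // z; exact: h.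
by have := h (pickle z) I; rewrite /H pickleK_inv.
Qed.

(** Margins only enlarge the product, so exceptional points are bad for all nonnegative margins;
    those allowed by [exists_rarely_bad] are taken, with any separation of the given lattice. *)
Lemma umean_exceptional (e : R) : (0 < d)%N -> 0 < e ->
  umean (fun v => (v \in exceptional)%:R) e.
Proof.
move=> d0 e0; have gU := lattice_basis_unit x.
have [l l0 gl] := unit_sep gU; have [M M0 bM] := exists_rarely_bad (R := R) d0 e0.
apply: umean_le (bM g l (fun=> l / M) gU l0 gl _) => // [v|i]; last first.
  by rewrite lexx andbT divr_ge0 ?ltW.
rewrite ler_nat; have [/set_mem ev|//] := boolP (v \in exceptional).
rewrite mem_set// => z; rewrite det_lattice_basis normr1 mulr1.
apply: lt_le_trans (ev z) _; rewrite normr_prod; apply: ler_prod => i _.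
by rewrite normr_ge0/= lerDl divr_ge0 ?ltW.
Qed.

End conclusion.

Theorem theorem3p2 (R : realType) (d : nat) (hd : (2 <= d)%N)
    (x : lattice R d) :
  (fiber_measure x).-negligible
    [set y : fiber x | ~ minkowski_conjecture (sval y)].
Proof.
have E : (fiber_proj x \o vec) @^-1` [set y : fiber x | ~ minkowski_conjecture (sval y)] =
    @vec R d @^-1` exceptional x.
  by apply/seteqP; split => t /=; move/not_minkowski.
have mA : measurable [set y : fiber x | ~ minkowski_conjecture (sval y)].
  rewrite /measurable /= /fiber_measurable /image_set_system /= setTI E.
  exact: measurable_exceptional.
apply/negligibleP => //.
have u (e : R) : 0 < e -> umean (fun v => (v \in exceptional x)%:R) e.
  by move=> e0; apply: umean_exceptional => //; exact: ltnW.
have := periodic_null (measurable_exceptional x) (@exceptional_lat _ _ x) u.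
by rewrite -E.
Qed.
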